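(* There exists an analytic stationary profile $(\rho_s(z),U_s(z))$, $z\in[-1,1]$, with $\rho_s'(z)<0$, satisfying $$0<\frac{-\rho_s'(z)}{|U_s'(z)|^2}<\frac14,$$ and such that the following holds. There exists $c\in\mathbb C$ with $\mathrm{Im}(c)>0$ such that for any $k\in\mathbb Z\setminus\{0\}$, the linearized hydrostatic equations $\partial_t(\varrho,\omega)=\mathscr L_{\rho_s,U_s}(\varrho,\omega)$ exhibit a real-valued solution (''growing mode'') of the form $$\varrho^{\mathrm{mod}}(t,x,z)=r(z)\,e^{k\,\mathrm{Im}(c)t}\cos\big(k(x-\mathrm{Re}(c)t)-\theta_1(z)\big),$$ $$\omega^{\mathrm{mod}}(t,x,z)=w(z)\,e^{k\,\mathrm{Im}(c)t}\cos\big(k(x-\mathrm{Re}(c)t)-\theta_2(z)\big),$$ where $r,w,\theta_1,\theta_2$ are smooth and real-valued nonzero functions. Moreover, the unstable spectrum of $\mathscr L_{\rho_s,U_s}$ is unbounded and contains all the eigenvalues $\lambda=-ikc$ with $k\in\mathbb Z$ such that $\mathrm{Re}(\lambda)=k\,\mathrm{Im}(c)>0$, associated to some smooth eigenmodes of the form $e^{ikx}(\widehat\varrho(z),\widehat\omega(z))$ for some non-zero regular functions $(\widehat\varrho(z),\widehat\omega(z))$.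
   Context: $(x,z)\in\mathbb T\times(-1,1)$, $\mathbb T=\mathbb R/(2\pi\mathbb Z)$. The linearization of the hydrostatic Euler-Boussinesq equations (in density-vorticity variables, $\omega=\partial_zu$) around the steady stratified shear flow $(\rho_s(z),U_s(z))$ is $\partial_t(\varrho,\omega)=\mathscr L_{\rho_s,U_s}(\varrho,\omega)$ with $$\mathscr L_{\rho_s,U_s}\begin{pmatrix}\varrho\\\omega\end{pmatrix}=\begin{pmatrix}-U_s(z)\partial_x\varrho+\rho_s'(z)\partial_x\varphi\\-U_s(z)\partial_x\omega+U_s''(z)\partial_x\varphi+\partial_x\varrho\end{pmatrix},\qquad \partial_z^2\varphi=\omega,\ \ \varphi|_{z=\pm1}=0.$$ The unstable spectrum is the part of the spectrum in $\{\mathrm{Re}>0\}$. *)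

(* Defs.v *)
From HB Require Import structures.
From mathcomp Require Import all_boot all_order all_algebra.
From mathcomp Require Import complex.
From mathcomp Require Import all_classical all_reals all_analysis.

Set Implicit Arguments.
Unset Strict Implicit.
Unset Printing Implicit Defensive.
Import Order.TTheory GRing.Theory Num.Theory.
Import numFieldNormedType.Exports.
Local Open Scope classical_set_scope.
Local Open Scope ring_scope.

Section Regularity.
Context {R : realType}.
Implicit Types f : R -> R.

Definition analytic_at f (z0 : R) : Prop :=
  exists (a : nat -> R) (e : R), 0 < e /\
    forall z, `|z - z0| < e -> pseries a (z - z0) @ \oo --> f z.

(* A function on [-1, 1] is represented by a function on R.  Only its values on
   [-1, 1] matter, but it has to be extended so that the two-sided derivatives
   at +1 and -1 exist: a function is analytic (resp. C^oo) on the closed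
   interval iff such an extension exists. *)
Definition analytic_on_I f : Prop :=
  forall z : R, z \in `[-1, 1] -> analytic_at f z.

Definition smooth_on_I f : Prop :=
  forall (n : nat) (z : R), z \in `[-1, 1] -> derivable f^`(n)%classic z 1.

Definition nonzero_on_I {T : nmodType} (f : R -> T) : Prop :=
  exists2 z : R, z \in `[-1, 1] & f z != 0.

Definition smoothC_on_I (f : R -> R[i]) : Prop :=
  smooth_on_I (fun z => complex.Re (f z)) /\
  smooth_on_I (fun z => complex.Im (f z)).

(* Directional derivatives of any order in the plane. *)
Definition diff_along (vs : seq (R * R)) (psi : R * R -> R) : R * R -> R :=
  foldr (fun v g => 'D_v g) psi vs.

Definition smooth_plane (psi : R * R -> R) : Prop :=
  forall vs : seq (R * R), continuous (diff_along vs psi) /\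
    forall p v, derivable (diff_along vs psi) p v.

(* Compactly supported smooth functions on T x (-1, 1): functions on T are the
   (2 pi)-periodic functions on R. *)
Definition test_function (psi : R * R -> R) : Prop :=
  [/\ smooth_plane psi,
      forall x z, psi (x + 2 * pi, z) = psi (x, z) &
      exists2 a : R, a < 1 & forall x z, a <= `|z| -> psi (x, z) = 0].

End Regularity.

Section ClassicalSolution.
Context {R : realType}.
Variables rho_s U_s : R -> R.

Definition dirichlet_classical (om ph : R -> R) : Prop :=
  [/\ {within `[-1, 1], continuous ph}, ph (-1) = 0, ph 1 = 0 &
      forall z : R, z \in `]-1, 1[ ->
        derivable ph z 1 /\ is_derive z 1 ph^`()%classic (om z)].

(* (rho, om)(t, x, z), real-valued, solves d_t (rho, om) = L (rho, om)
   pointwise on R x T x (-1, 1). *)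
Definition classical_solution (rho om : R -> R -> R -> R) : Prop :=
  (forall t x z, rho t (x + 2 * pi) z = rho t x z /\
                 om t (x + 2 * pi) z = om t x z) /\
  exists phi : R -> R -> R -> R,
    (forall t x, dirichlet_classical (om t x) (phi t x)) /\
    forall t x z : R, z \in `]-1, 1[ -> exists rho_x om_x phi_x : R,
      [/\ is_derive x 1 (fun y => rho t y z) rho_x,
          is_derive x 1 (fun y => om t y z) om_x,
          is_derive x 1 (fun y => phi t y z) phi_x,
          is_derive t 1 (fun s => rho s x z)
            (- U_s z * rho_x + rho_s^`()%classic z * phi_x) &
          is_derive t 1 (fun s => om s x z)
            (- U_s z * om_x + U_s^`(2)%classic z * phi_x + rho_x)].

End ClassicalSolution.

Section L2Operator.
Context {R : realType}.
Variables rho_s U_s : R -> R.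

Definition mu2 := (@lebesgue_measure R \x @lebesgue_measure R)%E.

(* Fundamental domain of T x (-1, 1); values outside of it are irrelevant. *)
Definition Omega : set (R * R) := `]0, 2 * pi[ `*` `]-1, 1[.

Definition L2 (f : R * R -> R) : Prop :=
  measurable_fun Omega f /\ (\int[mu2]_(p in Omega) (f p ^+ 2)%:E < +oo)%E.

(* ph is the H^2 solution of ph'' = om, ph(-1) = ph(1) = 0, for om merely
   integrable: ph' is the primitive of om with value p0 at -1. *)
Definition dirichlet_strong (om ph : R -> R) : Prop :=
  [/\ {within `[-1, 1], continuous ph}, ph (-1) = 0, ph 1 = 0 &
      exists p0 : R, forall z : R, z \in `]-1, 1[ ->
        is_derive z 1 ph
          (p0 + \int[@lebesgue_measure R]_(y in `]-1, z[) om y)%R].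

Definition stream_function (om phi : R * R -> R) : Prop :=
  L2 phi /\
  {ae @lebesgue_measure R, forall x : R, x \in `]0, 2 * pi[ ->
     dirichlet_strong (fun z => om (x, z)) (fun z => phi (x, z))}.

(* Graph of L_{rho_s, U_s} on real L^2(T x (-1, 1))^2 with its maximal domain:
   v is in the domain and L v = f, the derivative d_x being distributional
   (it commutes with the coefficients, which depend on z only). *)
Definition hydro_graphR (v f : (R * R -> R) * (R * R -> R)) : Prop :=
  [/\ L2 v.1, L2 v.2, L2 f.1, L2 f.2 &
  exists phi, stream_function v.2 phi /\
    forall psi, test_function psi ->
      \int[mu2]_(p in Omega) (f.1 p * psi p) =
      \int[mu2]_(p in Omega)
         ((U_s p.2 * v.1 p - rho_s^`()%classic p.2 * phi p)
          * 'D_((1, 0) : R * R) psi p)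
   /\ \int[mu2]_(p in Omega) (f.2 p * psi p) =
      \int[mu2]_(p in Omega)
         ((U_s p.2 * v.2 p - U_s^`(2)%classic p.2 * phi p - v.1 p)
          * 'D_((1, 0) : R * R) psi p)].

Definition state := ((R * R -> R[i]) * (R * R -> R[i]))%type.

Definition reS (v : state) :=
  (fun p => complex.Re (v.1 p), fun p => complex.Re (v.2 p)).
Definition imS (v : state) :=
  (fun p => complex.Im (v.1 p), fun p => complex.Im (v.2 p)).

Definition L2S (v : state) : Prop :=
  [/\ L2 (reS v).1, L2 (reS v).2, L2 (imS v).1 & L2 (imS v).2].

Definition sqnormS (v : state) : \bar R :=
  (\int[mu2]_(p in Omega) ((reS v).1 p ^+ 2 + (imS v).1 p ^+ 2
                         + (reS v).2 p ^+ 2 + (imS v).2 p ^+ 2)%:E)%E.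

(* L has real coefficients: complexification of the real operator. *)
Definition hydro_graph (v f : state) : Prop :=
  hydro_graphR (reS v) (reS f) /\ hydro_graphR (imS v) (imS f).

Definition scaleS (lam : R[i]) (v : state) : state :=
  (fun p => lam * v.1 p, fun p => lam * v.2 p).
Definition subS (v w : state) : state :=
  (fun p => v.1 p - w.1 p, fun p => v.2 p - w.2 p).

(* lam - L is a bijection from its domain onto L^2 (up to a.e. equality), with
   bounded inverse. *)
Definition resolvent_set : set R[i] := [set lam |
  exists M : R, forall f, L2S f ->
    exists v, [/\ hydro_graph v (subS (scaleS lam v) f),
      (sqnormS v <= M%:E * sqnormS f)%E &
      forall v', hydro_graph v' (subS (scaleS lam v') f) ->
        {ae mu2, forall p, Omega p -> v'.1 p = v.1 p /\ v'.2 p = v.2 p}]].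

Definition spectrum : set R[i] := ~` resolvent_set.

Definition unstable_spectrum : set R[i] :=
  spectrum `&` [set lam | 0 < complex.Re lam].

Definition expi (y : R) : R[i] := (cos y +i* sin y)%C.

Definition fourier_mode (k : int) (rhat what : R -> R[i]) : state :=
  (fun p => expi (k%:~R * p.1) * rhat p.2,
   fun p => expi (k%:~R * p.1) * what p.2).

End L2Operator.

(* Main.v *)
Require Import Defs.
From HB Require Import structures.
From mathcomp Require Import all_boot all_order all_algebra.
From mathcomp Require Import complex ring lra.
From mathcomp Require Import all_classical all_reals all_analysis.
Set Implicit Arguments.
Unset Strict Implicit.
Unset Printing Implicit Defensive.
Import Order.TTheory GRing.Theory Num.Theory.
Import numFieldNormedType.Exports.
Local Open Scope classical_set_scope.
Local Open Scope ring_scope.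

(** Look for an unstable mode with [c = i].  For [phi = (U - i) chi] the mode
    equation becomes [((U - i)^2 chi')' + N^2 chi = 0] with [N^2 = - rho_s'].
    Writing [(U - i) chi' / chi = f + i g], its imaginary part integrates to
    [U = (f - h) / g] where [h' = 2 f g], and its real part then gives
    [N^2 = g^2 - f^2 - g' - (U f)'].  So every choice of [g] and [h] yields a
    profile carrying an explicit mode, and only [0 < N^2 < U'^2 / 4] and the
    regularity at the walls, where [chi] vanishes, have to be arranged.  With
    [w = z^2], [s = 1 + 11 w] and [t = 1 + 2 w], the choice
    [g = 8 z t / (s (1 - w))] and
    [f = - 8 (6 + 55 w + 341 w^2) / (s t (1 - w))] gives rational [U] and [N^2].
    Since the equation does not involve the wave number, each [k] gives the
    eigenvalue [- i k c = k]; the eigenfunctions defeat the uniqueness required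
    in the resolvent set. *)

(** * Smooth functions on the line *)

(** The numerator [6 + 55 w + 341 w^2] of [f] is chosen so that [2 f g] has a primitive without
    logarithm, [h = - 16 (3 + 54 w + 77 w^2) / (s (1 - w))]; this is what makes [U] rational. The
    constant of integration gives [f = h] at [z = 0], where [g] vanishes, so the quotient
    [(f - h) / g] is regular there. At the walls [f], [g] and [h] have simple poles, which leave [U]
    finite. A simple zero of [chi] at [w = 1] requires [(1 - w) (f + i g) = - 2 z (U - i)] there:
    the imaginary part holds because [8 t / s = 2], the real part because [(1 - w) f = - 268 / 3]
    and [U(1) = 134 / 3]. As [s] and [t] are positive for [w >= 0], no other singularity occurs, and
    the mode equations become identities between rational functions. *)

Section SmoothFunctions.
Context {R : realType}.
Implicit Types f g df dg : R -> R.

(** Recursion on the derivative turns each closure property into an induction on the order.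
    Derivatives on the whole line can be demanded because the functions of the proof come from
    rational functions without real poles by integration, [expR], [cos], [sin] and [atan]. *)
Fixpoint differentiable_upto (n : nat) f : Prop :=
  if n is m.+1 then (forall x, derivable f x 1) /\ differentiable_upto m f^`()%classic
  else True.

Definition smooth f : Prop := forall n, differentiable_upto n f.

Lemma differentiable_uptoS n f df : (forall x : R, is_derive x 1 f (df x)) ->
  differentiable_upto n df -> differentiable_upto n.+1 f.
Proof.
move=> fd ndf; split; first by move=> x; case: (fd x).
suff -> : f^`()%classic = df by [].
by apply/funext => x; rewrite derive1E; case: (fd x).
Qed.

Lemma differentiable_upto_derive n f : differentiable_upto n.+1 f ->
  exists2 df, (forall x : R, is_derive x 1 f (df x)) & differentiable_upto n df.
Proof.
move=> [fd ndf]; exists f^`()%classic => // x.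
by rewrite derive1E; exact: derivableP.
Qed.

Lemma differentiable_uptoW n f :
  differentiable_upto n.+1 f -> differentiable_upto n f.
Proof.
elim: n f => [//|n IH] f [fd ndf]; split => //; exact: IH.
Qed.

Lemma smooth_antiderivative f df :
  (forall x : R, is_derive x 1 f (df x)) -> smooth df -> smooth f.
Proof.
by move=> fd sdf [//|n]; exact: differentiable_uptoS fd (sdf n).
Qed.

Lemma smooth_derivable f x : smooth f -> derivable f x 1.
Proof. by move=> /(_ 1) []. Qed.

Lemma smooth_continuous f : smooth f -> continuous f.
Proof.
by move=> sf x; apply/differentiable_continuous/derivable1_diffP/smooth_derivable.
Qed.

Lemma smooth_derive1n f n x : smooth f -> derivable f^`(n)%classic x 1.
Proof.
elim: n f => [|n IH] f sf; first exact: smooth_derivable.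
by rewrite /derive1n iterSr; apply: IH => m; have [] := sf m.+1.
Qed.

Lemma smooth_smooth_on_I f : smooth f -> smooth_on_I f.
Proof. by move=> sf n z _; exact: smooth_derive1n. Qed.

Lemma smooth_cst (a : R) : smooth (fun=> a).
Proof.
have s0 : smooth (fun=> 0 : R).
  elim=> [//|n IH]; apply: differentiable_uptoS IH => x; exact: is_derive_cst.
apply: smooth_antiderivative s0 => x; exact: is_derive_cst.
Qed.

Lemma smooth_id : smooth (fun x : R => x).
Proof.
apply: smooth_antiderivative (smooth_cst 1) => x; exact: is_derive_id.
Qed.

Lemma differentiable_uptoD n f g : differentiable_upto n f ->
  differentiable_upto n g -> differentiable_upto n (fun x => f x + g x).
Proof.
elim: n f g => [//|n IH] f g /differentiable_upto_derive[df fd ndf].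
move=> /differentiable_upto_derive[dg gd ndg].
by apply: (@differentiable_uptoS _ _ (fun x => df x + dg x)); last exact: IH.
Qed.

Lemma differentiable_uptoM n f g : differentiable_upto n f ->
  differentiable_upto n g -> differentiable_upto n (fun x => f x * g x).
Proof.
elim: n f g => [//|n IH] f g nf ng.
have [df fd ndf] := differentiable_upto_derive nf.
have [dg gd ndg] := differentiable_upto_derive ng.
apply: (@differentiable_uptoS _ _ (fun x => df x * g x + f x * dg x)).
  by move=> x; apply: is_derive_eq; rewrite /GRing.scale/=; ring.
by apply: differentiable_uptoD; apply: IH => //; exact: differentiable_uptoW.
Qed.

Lemma smoothD f g : smooth f -> smooth g -> smooth (fun x => f x + g x).
Proof. by move=> sf sg n; exact: differentiable_uptoD. Qed.

Lemma smoothM f g : smooth f -> smooth g -> smooth (fun x => f x * g x).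
Proof. by move=> sf sg n; exact: differentiable_uptoM. Qed.

Lemma smoothN f : smooth f -> smooth (fun x => - f x).
Proof.
move=> sf; rewrite (_ : (fun x => _) = fun x => (-1) * f x).
  by apply: smoothM sf; exact: smooth_cst.
by apply/funext => x; rewrite mulN1r.
Qed.

Lemma smoothB f g : smooth f -> smooth g -> smooth (fun x => f x - g x).
Proof. by move=> sf sg; apply: smoothD sf _; exact: smoothN. Qed.

Lemma smoothX f n : smooth f -> smooth (fun x => f x ^+ n).
Proof.
move=> sf; elim: n => [|n IH]; first exact: smooth_cst.
by under eq_fun do rewrite exprS; exact: smoothM.
Qed.

Lemma smooth_comp g f : smooth g -> smooth f -> smooth (fun x => g (f x)).
Proof.
move=> sg sf n; elim: n g sg => [//|n IH] g sg.
have [dg gd _] := differentiable_upto_derive (sg 1).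
(* Each order supplies its own derivative of [g]; uniqueness of derivatives identifies them all with
   [dg]. *)
have sdg : smooth dg.
  move=> m; have [dg' gd' ndg'] := differentiable_upto_derive (sg m.+1).
  suff -> : dg = dg' by [].
  by apply/funext => x; case: (gd x) => _ <-; case: (gd' x).
have [df fd ndf] := differentiable_upto_derive (sf n.+1).
apply: (@differentiable_uptoS _ _ (fun x => dg (f x) * df x)).
by apply: differentiable_uptoM => //; exact: IH.
Qed.

Lemma smooth_expR f : smooth f -> smooth (fun x => expR (f x)).
Proof.
apply: smooth_comp; elim=> [//|n IH].
exact: differentiable_uptoS (@is_derive_expR R) IH.
Qed.

Lemma smooth_cos f : smooth f -> smooth (fun x => cos (f x)).
Proof.
apply: smooth_comp.
suff H n : differentiable_upto n (@cos R) /\ differentiable_upto n (@sin R).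
  by move=> n; case: (H n).
elim: n => [//|n [IHc IHs]]; split.
  apply: differentiable_uptoS (@is_derive_cos R) _.
  rewrite (_ : (fun x => _) = fun x => (-1) * sin x); last first.
    by apply/funext => x; rewrite mulN1r.
  apply: differentiable_uptoM => //; exact: smooth_cst.
exact: differentiable_uptoS (@is_derive_sin R) IHc.
Qed.

Lemma smooth_sin f : smooth f -> smooth (fun x => sin (f x)).
Proof.
apply: smooth_comp; apply: smooth_antiderivative (@is_derive_sin R) _.
by apply: smooth_cos; exact: smooth_id.
Qed.

(** The derivative of [1 / f] contains the reciprocal again, which the induction hypothesis covers
    at the lower order; hence the product of two inverses in place of the inverse of a square. *)
Lemma smoothV f : (forall x, f x != 0) -> smooth f -> smooth (fun x => (f x)^-1).
Proof.
move=> f0 sf; elim=> [//|n IH].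
have [df fd ndf] := differentiable_upto_derive (sf n.+1).
apply: (@differentiable_uptoS _ _ (fun x => (- 1) * df x * ((f x)^-1 * (f x)^-1))).
  move=> x; have fV := @is_deriveV R f x (df x) 1 (f0 x) (fd x).
  apply: is_derive_eq fV _; rewrite /GRing.scale/=.
  by rewrite expr2 invfM; ring.
do 2![apply: differentiable_uptoM => //].
exact: smooth_cst.
Qed.

Lemma smooth_atan f : smooth f -> smooth (fun x => atan (f x)).
Proof.
apply: smooth_comp; apply: smooth_antiderivative (@is_derive1_atan R) _.
apply: smoothV => [x|]; first by rewrite gt_eqF// ltr_pwDl// sqr_ge0.
apply: smoothD; [exact: smooth_cst|apply: smoothX; exact: smooth_id].
Qed.

End SmoothFunctions.

(** * Antiderivatives and analyticity of rational functions *)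

Section Antiderivative.
Context {R : realType}.
Local Notation mu := (@lebesgue_measure R).

Lemma continuous_integrable_itv (f : R -> R) (a b : R) : continuous f ->
  mu.-integrable `[a, b] (EFin \o f).
Proof.
move=> cf; apply: continuous_compact_integrable; first exact: segment_compact.
exact: continuous_subspaceT.
Qed.

(** An integral over [[a, x]] has no orientation, so the base point has to lie to the left of both
    [x] and [0] and must move with [x]. The difference of the two integrals does not depend on it,
    so locally the base point can be frozen and the fundamental theorem applied. *)
Lemma exists_antiderivative (f : R -> R) (c : R) : continuous f ->
  exists2 F : R -> R, F 0 = c & forall x : R, is_derive x 1 F (f x).
Proof.
move=> cf.
pose G (a x : R) := \int[mu]_(t in `[a, x]) f t - \int[mu]_(t in `[a, 0]) f t.
have Gstep a b x : a <= b -> b <= x ->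
  \int[mu]_(t in `[a, x]) f t =
  \int[mu]_(t in `[a, b]) f t + \int[mu]_(t in `[b, x]) f t.
  move=> ab bx.
  have := @Rintegral_itvB _ f (BLeft a) (BRight x) b
    (continuous_integrable_itv _ _ cf).
  rewrite !bnd_simp => /(_ ab bx) /eqP; rewrite subr_eq addrC => /eqP ->.
  congr (_ + _); apply: Rintegral_itv_obnd_cbnd.
  apply: integrableS (continuous_integrable_itv b x cf).
  - exact: measurable_itv.
  - exact: measurable_itv.
  - exact: subset_itv_oc_cc.
have Gindep a b x : a <= b -> b <= x -> b <= 0 -> G a x = G b x.
  by move=> ab bx b0; rewrite /G (Gstep a b x)// (Gstep a b 0)//; ring.
exists (fun x => G (- (`|x| + 1)) x + c).
  by rewrite /G subrr add0r.
(* The extra unit keeps [a] to the left of the base point [- (|y| + 1)] for every [y] within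
   distance 1 of [x]. *)
move=> x; set a := - (`|x| + 2).
have ax : a < x by rewrite /a; have := lerNnormlW (lexx `|x|); lra.
have Gd : is_derive x 1 (fun y => G a y + c) (f x).
  have [] := @continuous_FTC1_closed _ f a x (x + 1) _
    (continuous_integrable_itv _ _ cf) ax (cf x); first by lra.
  rewrite derive1E => Id If; have {}If := DeriveDef Id If.
  have : is_derive x 1 (fun y => G a y + c) (f x - 0 + 0).
    exact: (is_deriveD (is_deriveB If (is_derive_cst _ _ _)) (is_derive_cst _ _ _)).
  by rewrite subr0 addr0.
apply: near_eq_is_derive Gd; near=> y.
have yx : `|x - y| < 1 by near: y; exact: nbhsx_ballx.
congr (_ + _); have := lerB_dist y x; rewrite distrC => yx'.
have yN := lerNnormlW (lexx `|y|); have y0 := normr_ge0 y.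
by apply: Gindep; rewrite /a; lra.
Unshelve. all: by end_near. Qed.

End Antiderivative.

(** * Power series expansions with a geometric error bound *)

Section AnalyticRational.
Context {R : realType}.
Implicit Types p q : {poly R}.

(** Division of power series: a new coefficient needs all the earlier ones, so the recursion carries
    the list of the first [n]. *)
Fixpoint quotient_coefs p q n : seq R :=
  if n is m.+1 then
    let l := quotient_coefs p q m in
    rcons l ((p`_m - \sum_(j < m) q`_j.+1 * l`_(m - j.+1)) / q`_0)
  else [::].

Lemma exists_quotient_coefs p q : q`_0 != 0 ->
  exists c : nat -> R, forall n, \sum_(j < n.+1) q`_j * c (n - j)%N = p`_n.
Proof.
move=> q0; pose l := quotient_coefs p q; pose c n := (l n.+1)`_n.
have szl n : size (l n) = n by elim: n => //= n IH; rewrite size_rcons IH.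
have lc n i : (i < n)%N -> (l n)`_i = c i.
  elim: n => // n IH; rewrite ltnS leq_eqVlt => /predU1P[->//|lin].
  by rewrite /l /= nth_rcons szl lin; exact: IH.
exists c => n; rewrite big_ord_recl /= subn0 {1}/c /l /= nth_rcons szl ltnn eqxx.
rewrite mulrC divfK// -/l.
rewrite [X in _ - X](_ : _ = \sum_(j < n) q`_j.+1 * c (n - j.+1)%N) ?subrK//.
by apply: eq_bigr => j _; rewrite lc// ltn_subrL (leq_ltn_trans _ (ltn_ord j)).
Qed.

(** A rate that is uniform in [h] survives integration by the mean value theorem, which bare
    convergence of the series would not. The ratio 1/2 is reached by shrinking the radius [e]. *)
Definition geometric_expansion (f : R -> R) (z0 : R) :=
  exists (a : nat -> R) (e C : R), 0 < e /\ forall N h, `|h| < e ->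
    `|f (z0 + h) - \sum_(n < N) a n * h ^+ n| <= C * 2^-1 ^+ N.

Definition coef_norm p := \sum_(i < size p) `|p`_i|.

Lemma coef_norm_ge0 p : 0 <= coef_norm p.
Proof. exact: sumr_ge0. Qed.

Lemma sum_coef_le p n : \sum_(i < n) `|p`_i| <= coef_norm p.
Proof.
have tailS k : \sum_(i < size p + k) `|p`_i| = coef_norm p.
  elim: k => [|k IH]; first by rewrite addn0.
  by rewrite addnS big_ord_recr/= IH nth_default ?leq_addr// normr0 addr0.
rewrite -(tailS n) addnC big_split_ord/= lerDl; exact: sumr_ge0.
Qed.

Lemma coef_le p n : `|p`_n| <= coef_norm p.
Proof.
apply: le_trans (sum_coef_le p n.+1).
by rewrite big_ord_recr/= lerDr; exact: sumr_ge0.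
Qed.

(** By the recursion, [|q_0| |c_n|] is at most [|p_n|] plus the convolution of [q] with the earlier
    coefficients. The factors 2 in the constant and in [r] make each of the two at most half of the
    target. *)
Lemma quotient_coefs_bound p q (c : nat -> R) (r := 2 * coef_norm q / `|q`_0|) :
  q`_0 != 0 -> (forall n, \sum_(j < n.+1) q`_j * c (n - j)%N = p`_n) ->
  forall n, `|c n| <= 2 * coef_norm p / `|q`_0| * r ^+ n.
Proof.
move=> q0 cE; have A0 : 0 < `|q`_0| by rewrite normr_gt0.
have An0 : `|q`_0| != 0 by rewrite normr_eq0.
have r1 : 1 <= r.
  rewrite ler_pdivlMr// mul1r (le_trans (coef_le q 0))//.
  by rewrite mulr_natl mulr2n lerDl coef_norm_ge0.
have r0 : 0 <= r by exact: le_trans r1.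
have Sp0 := coef_norm_ge0 p.
set M := _ / _; have M0 : 0 <= M by rewrite divr_ge0// mulr_ge0.
elim/ltn_ind => n IH; have := cE n; rewrite big_ord_recl/= subn0.
move/eqP; rewrite eq_sym -subr_eq => /eqP q0c.
rewrite -(ler_pM2l A0) -normrM -q0c (le_trans (ler_normB _ _))//.
have Sp_le : `|p`_n| <= `|q`_0| * (M * r ^+ n) / 2.
  apply: le_trans (coef_le p n) _.
  rewrite (_ : _ / 2 = coef_norm p * r ^+ n); last first.
    by rewrite /M; field.
  by rewrite ler_peMr// exprn_ege1.
suff sum_le : `|\sum_(i < n) q`_(bump 0 i) * c (n - bump 0 i)%N| <=
    `|q`_0| * (M * r ^+ n) / 2 by lra.
case: n => [|n] in IH cE q0c Sp_le *.
  by rewrite big_ord0 normr0 divr_ge0// mulr_ge0// mulr_ge0.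
rewrite (le_trans (ler_norm_sum _ _ _))//.
apply: (@le_trans _ _ (\sum_(i < n.+1) `|q`_i.+1| * (M * r ^+ n))).
  apply: ler_sum => i _; rewrite normrM ler_wpM2l//.
  rewrite (le_trans (IH _ _)) ?ltn_subrL// ler_wpM2l// ler_weXn2l//.
  by rewrite leq_subLR /bump /= add1n addSn ltnS leq_addl.
rewrite -mulr_suml (_ : _ / 2 = coef_norm q * (M * r ^+ n)); last first.
  by rewrite exprS /r; field.
rewrite ler_wpM2r ?mulr_ge0 ?exprn_ge0//.
apply: le_trans (sum_coef_le q n.+2); rewrite [leRHS]big_ord_recl/=.
by rewrite lerDr.
Qed.

Lemma horner_lower_bound q (h : R) : q`_0 != 0 -> `|h| <= 1 ->
  `|h| * coef_norm q <= `|q`_0| / 2 -> `|q`_0| / 2 <= `|q.[h]|.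
Proof.
move=> q0 h1 hS.
have : `|q.[h] - q`_0| <= `|q`_0| / 2.
  apply: le_trans hS; rewrite horner_coef.
  have : (0 < size q)%N.
    by case: (size q) (@nth_default _ 0 q 0) q0 => // /(_ isT) ->; rewrite eqxx.
  have := sum_coef_le q (size q).
  case: (size q) => // n; rewrite !big_ord_recl/= expr0 mulr1 => Sn _.
  rewrite [_ + _ - _]addrC addKr (le_trans (ler_norm_sum _ _ _))//.
  apply: (@le_trans _ _ (`|h| * \sum_(i < n) `|q`_(bump 0 i)|)).
    rewrite mulr_sumr; apply: ler_sum => i _; rewrite normrM mulrC ler_wpM2r//.
    by rewrite normrX /bump /= add1n exprS ler_piMr// exprn_ile1.
  by rewrite ler_wpM2l// (le_trans _ Sn)// lerDr.
have := ler_normB q.[h] (q.[h] - q`_0).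
by rewrite opprB addrC subrK => H1 H2; lra.
Qed.

(** For the truncated series [S], the polynomial [E = p - q S] has no coefficient below [N] and at
    most [D] beyond. Each of its terms is at most [K (r |h|)^n] with [r |h| <= 1/2], and dividing by
    [q] costs a factor [2 / |q_0|]. *)
Lemma rational_geometric_expansion0 p q : q`_0 != 0 ->
  geometric_expansion (fun z => p.[z] / q.[z]) 0.
Proof.
move=> q0; have [c cE] := exists_quotient_coefs p q0.
have A0 : 0 < `|q`_0| by rewrite normr_gt0.
have An0 : `|q`_0| != 0 by rewrite normr_eq0.
have := quotient_coefs_bound q0 cE; set r := 2 * coef_norm q / _; set M := _ / _.
move=> c_le.
have Sp0 := coef_norm_ge0 p; have Sq0 := coef_norm_ge0 q.
have Aq : `|q`_0| <= coef_norm q by exact: coef_le.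
have r2 : 2 <= r by rewrite ler_pdivlMr// ler_wpM2l.
have M0 : 0 <= M by rewrite divr_ge0// mulr_ge0.
pose K := coef_norm p + coef_norm q * M; pose D := (size p + size q)%N.
(* This radius gives [r |h| <= 1/2] and, by the definition of [r], also the smallness of [|h|] that
   keeps [|q.[h]|] above [|q_0| / 2]. *)
exists c, (2 * r)^-1, (2 / `|q`_0| * (D%:R * K)); split.
  by rewrite invr_gt0; lra.
move=> N h hr; rewrite add0r.
have rh : r * `|h| <= 2^-1.
  rewrite (_ : 2^-1 = r * (2 * r)^-1); first by rewrite ler_wpM2l ?ltW//; lra.
  by field; lra.
have h0 := normr_ge0 h.
have h1 : `|h| <= 1 by nra.
have qh : `|q`_0| / 2 <= `|q.[h]|.
  apply: horner_lower_bound => //.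
  have : r * `|q`_0| = 2 * coef_norm q by rewrite /r; field; rewrite normr_eq0.
  by nra.
have qh0 : q.[h] != 0 by rewrite -normr_gt0; lra.
pose S := \poly_(i < N) c i; pose E := p - q * S.
rewrite (_ : \sum_(n < N) c n * h ^+ n = S.[h]); last by rewrite horner_poly.
rewrite (_ : _ - S.[h] = E.[h] / q.[h]); last first.
  by rewrite /E !hornerE; field.
suff Eh : `|E.[h]| <= D%:R * K * 2^-1 ^+ N.
  rewrite normrM normfV ler_pdivrMr ?normr_gt0// (le_trans Eh)//.
  rewrite [leRHS](_ : _ = (2 / `|q`_0| * `|q.[h]|) * (D%:R * K * 2^-1 ^+ N)); last by ring.
  apply: ler_peMl; first by rewrite !mulr_ge0 ?exprn_ge0 ?invr_ge0// addr_ge0// mulr_ge0.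
  by rewrite mulrAC ler_pdivlMr// mul1r; lra.
have E_small n : (n < N)%N -> E`_n = 0.
  move=> nN; rewrite coefB coefM -(cE n) -sumrB big1// => j _.
  by rewrite coef_poly (leq_ltn_trans (leq_subr _ _) nN) subrr.
have E_le n : `|E`_n| <= K * r ^+ n.
  have rn : 1 <= r ^+ n by rewrite exprn_ege1; lra.
  rewrite coefB (le_trans (ler_normB _ _))// /K mulrDl lerD//.
    by rewrite (le_trans (coef_le p n))// ler_peMr.
  rewrite coefM (le_trans (ler_norm_sum _ _ _))//.
  apply: (@le_trans _ _ (\sum_(i < n.+1) `|q`_i| * (M * r ^+ n))).
    apply: ler_sum => i _; rewrite normrM ler_wpM2l// coef_poly.
    case: ifP => _; last by rewrite normr0 mulr_ge0//; lra.
    rewrite (le_trans (c_le _))// ler_wpM2l// ler_weXn2l ?leq_subr//; lra.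
  rewrite -mulr_suml -mulrA ler_wpM2r ?sum_coef_le// mulr_ge0//; lra.
have Esize : (size E <= N + D)%N.
  rewrite (leq_trans (size_polyD _ _))// size_polyN geq_max /D; apply/andP; split.
    by rewrite addnCA leq_addr.
  rewrite (leq_trans (size_polyMleq _ _))// (leq_trans (leq_pred _))//.
  rewrite addnC addnCA [in leqRHS]addnA leq_add ?size_poly//.
  by rewrite (leq_trans (size_poly _ _))// leq_addl.
rewrite (horner_coef_wide _ Esize) big_split_ord/= big1 ?add0r; last first.
  by move=> i _; rewrite E_small ?mul0r.
rewrite (le_trans (ler_norm_sum _ _ _))// -mulrA.
rewrite [leRHS](_ : _ = \sum_(i < D) (K * 2^-1 ^+ N)); last first.
  by rewrite sumr_const card_ord mulr_natl.
apply: ler_sum => i _; rewrite normrM normrX.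
apply: le_trans (ler_wpM2r (exprn_ge0 _ h0) (E_le _)) _.
rewrite -mulrA -exprMn ler_wpM2l ?addr_ge0 ?mulr_ge0//.
apply: (@le_trans _ _ (2^-1 ^+ (N + i))); first by rewrite lerXn2r// nnegrE; nra.
by rewrite exprD ler_piMr ?exprn_ge0// exprn_ile1//; lra.
Qed.

Lemma rational_geometric_expansion p q z0 : q.[z0] != 0 ->
  geometric_expansion (fun z => p.[z] / q.[z]) z0.
Proof.
move=> qz0; pose sh (r : {poly R}) := r \Po ('X + z0%:P).
have shE r h : (sh r).[h] = r.[z0 + h] by rewrite /sh horner_comp !hornerE addrC.
have := @rational_geometric_expansion0 (sh p) (sh q).
rewrite -horner_coef0 shE addr0 => /(_ qz0)[a [e [C [e0 aE]]]].
by exists a, e, C; split=> // N h /(aE N); rewrite add0r !shE.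
Qed.

Lemma cvg_geometric_bound (u : R^nat) (l C : R) :
  (forall N, `|l - u N| <= C * 2^-1 ^+ N) -> u @ \oo --> l.
Proof.
move=> uC.
have C0 : (fun N => C * 2^-1 ^+ N) @ \oo --> (0 : R).
  by apply: cvg_geometric; rewrite ger0_norm; lra.
apply/cvgrPdist_le => eps eps0.
have /cvgrPdist_le /(_ _ eps0) := C0; apply: filterS => N.
rewrite sub0r normrN => CN; apply: le_trans (uC N) (le_trans (ler_norm _) CN).
Qed.

Lemma geometric_expansion_analytic (f : R -> R) z0 :
  geometric_expansion f z0 -> analytic_at f z0.
Proof.
move=> [a [e [C [e0 aE]]]]; exists a, e; split=> // z ze.
apply: (@cvg_geometric_bound _ _ C) => N.
by rewrite /pseries /series /= big_mkord -{1}[z](subrK z0) [_ - _ + _]addrC; exact: aE.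
Qed.

(** The remainder [D] of [F] vanishes at 0 and its derivative is the remainder of [f], so the mean
    value theorem bounds it by [C 2^-N |h|]. *)
Lemma geometric_expansion_antiderivative (f F : R -> R) z0 :
  (forall x : R, is_derive x 1 F (f x)) ->
  geometric_expansion f z0 -> analytic_at F z0.
Proof.
move=> Ff [a [e [C [e0 aE]]]].
pose A n := if n is m.+1 then a m / m.+1%:R else F z0.
exists A, e; split=> // z ze; set h := z - z0 in ze *.
have zE : z = z0 + h by rewrite /h addrC subrK.
(* Integration raises the degree by one: [N] terms of the series of [f] correspond to [N + 1] terms
   of that of [F]. *)
rewrite -(cvg_shiftS (pseries A h)) zE.
apply: (@cvg_geometric_bound _ _ (C * e)) => N.
pose D y := F (z0 + y) - (\poly_(i < N.+1) A i).[y].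
pose dD y := f (z0 + y) - \sum_(n < N) a n * y ^+ n.
have DdD (y : R) : is_derive y 1 D (dD y).
  have Fy : is_derive y 1 (fun y => F (z0 + y)) (f (z0 + y) * (0 + 1)).
    have shd : is_derive y 1 (fun y => z0 + y) (0 + 1) by exact: is_deriveD.
    exact: (@is_derive1_comp _ F (fun y => z0 + y)).
  apply: is_derive_eq (is_deriveB Fy (is_derive_poly _ y)) _.
  rewrite add0r mulr1; congr (_ - _).
  rewrite (_ : _^`() = \poly_(i < N) a i)%R ?horner_poly//.
  apply/polyP => i; rewrite coef_deriv !coef_poly ltnS; case: ifP => // _.
    by rewrite /A -[LHS]mulr_natr divfK// pnatr_eq0.
  by rewrite mul0rn.
have dD_le y : `|y| <= `|h| -> `|dD y| <= C * 2^-1 ^+ N.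
  by move=> yh; apply: aE; exact: le_lt_trans ze.
have D_le : `|D h - D 0| <= C * 2^-1 ^+ N * `|h|.
  have cD (x y : R) : {within `[x, y], continuous D}.
    apply: continuous_subspaceT => u.
    by apply/differentiable_continuous/derivable1_diffP; case: (DdD u).
  have [h0|/ltW h0] := leP 0 h.
    have [c cI ->] := MVT_segment h0 (fun y _ => DdD y) (cD _ _).
    rewrite subr0 normrM ler_wpM2r// dD_le//.
    by move: cI; rewrite in_itv/= => /andP[c0 ch]; rewrite !ger0_norm.
  have [c cI] := MVT_segment h0 (fun y _ => DdD y) (cD _ _).
  rewrite distrC => ->; rewrite sub0r normrM normrN ler_wpM2r// dD_le//.
  by move: cI; rewrite in_itv/= => /andP[ch c0]; rewrite !ler0_norm// lerN2.
have D0 : D 0 = 0 by rewrite /D addr0 horner_coef0 coef_poly /= subrr.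
rewrite D0 subr0 in D_le.
rewrite /pseries /series /= big_mkord -horner_poly (le_trans D_le)//.
have C0 : 0 <= C * 2^-1 ^+ N by apply: le_trans (dD_le 0 _); rewrite ?normr0.
by rewrite [leRHS]mulrAC ler_wpM2l// ltW.
Qed.

End AnalyticRational.

(** * The explicit profile and its mode *)

Section Profile.
Context {R : realType}.
Implicit Types w z : R.

(* [w] stands for [z^2]. *)
Definition tfac w := 1 + 2 * w.
Definition sfac w := 1 + 11 * w.
(** Here [f - h = 8 w shear_num / (s t (1 - w))]; dividing by [g] cancels [s (1 - w)] and leaves
    [U = z shear_num / t^2]. *)
Definition shear_num w := 65 + 29 * w + 308 * w ^+ 2.
Definition dshear_num w := 65 - 303 * w + 1482 * w ^+ 2 + 616 * w ^+ 3.
Definition ddshear_num w := 18 * (- 77 + 464 * w - 124 * w ^+ 2).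
(** The last four coefficients are 16490, 135299, -1004722 and 2310776, split into smaller
    numerals. *)
Definition bvf_num w := 101 - 2779 * w + 1649 * 10 * w ^+ 2
  + (135 * 1000 + 299) * w ^+ 3 - (1004 * 1000 + 722) * w ^+ 4
  + (2310 * 1000 + 776) * w ^+ 5.
(** This is [t^4 (1 + U^2)]; the factor [1 + U^2 = |U - i|^2] comes from dividing by [U - i]. *)
Definition disc w := tfac w ^+ 4 + w * shear_num w ^+ 2.

Definition shear z := z * shear_num (z ^+ 2) / tfac (z ^+ 2) ^+ 2.
Definition dshear z := dshear_num (z ^+ 2) / tfac (z ^+ 2) ^+ 3.
Definition ddshear z := z * (ddshear_num (z ^+ 2) / tfac (z ^+ 2) ^+ 4).
Definition bvf z :=
  8 * bvf_num (z ^+ 2) / (tfac (z ^+ 2) ^+ 4 * sfac (z ^+ 2) ^+ 2).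

(* The mode is [chi = (1 - w) E] with [E' / E = z growth w + i rotation w]. *)
Definition growth w := - 2 * (3 * tfac w ^+ 4 + shear_num w *
  (24 + 227 * w + 1287 * w ^+ 2 + 3388 * w ^+ 3)) / (sfac w * disc w).
(** The imaginary part of [(f + i g) / (U - i)] is [(f + g U) / (1 + U^2)]. Its numerator has the
    factor [1 - w], which cancels the wall poles; in [growth] they are removed by the logarithmic
    derivative of [1 - w]. *)
Definition rotation w :=
  - 16 * (3 - 2 * w + 154 * w ^+ 2) * tfac w ^+ 3 / (sfac w * disc w).

(* [phi' = (phi_re w + i z phi_im w) E]; [dphi_re] and [dphi_im] are the
   derivatives of [phi_re (z^2)] and [z phi_im (z^2)], the first divided by [z]. *)
Definition phi_re w := (1 - w) * (dshear_num w / tfac w ^+ 3)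
  - 8 * (6 + 55 * w + 341 * w ^+ 2) / (sfac w * tfac w).
Definition phi_im w := 8 * tfac w / sfac w.
Definition dphi_re w := - 2 * (dshear_num w / tfac w ^+ 3)
  + (1 - w) * (ddshear_num w / tfac w ^+ 4)
  - 16 * ((55 + 682 * w) * (sfac w * tfac w)
          - (6 + 55 * w + 341 * w ^+ 2) * (13 + 44 * w)) / (sfac w * tfac w) ^+ 2.
Definition dphi_im w := 8 * (1 - 5 * w + 22 * w ^+ 2) / sfac w ^+ 2.

(* [phi'' = (1 - w) (z om_re w + i om_im w) E]. *)
Definition om_im w :=
  - (8 * bvf_num w / (tfac w ^+ 4 * sfac w ^+ 2)) * (tfac w ^+ 4 / disc w).
Definition om_re w := ddshear_num w / tfac w ^+ 4
  + shear_num w / tfac w ^+ 2 * om_im w.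

Lemma tfac_gt0 w : 0 <= w -> 0 < tfac w.
Proof. by rewrite /tfac; lra. Qed.

Lemma sfac_gt0 w : 0 <= w -> 0 < sfac w.
Proof. by rewrite /sfac; lra. Qed.

Lemma disc_gt0 w : 0 <= w -> 0 < disc w.
Proof.
by move=> w0; rewrite ltr_pwDl ?exprn_gt0 ?tfac_gt0// mulr_ge0 ?sqr_ge0.
Qed.

(** The quintic falls from 101 at 0 to below 12 near [w = 1/16]. The squares offered to [lra]
    therefore all have a root at 1/16 or 1/17, and a nonnegative combination of them certifies
    positivity. *)
Lemma bvf_num_gt0 w : 0 <= w -> 0 < bvf_num w.
Proof.
move=> w0.
have sq0 k x : 0 <= w ^+ k * x ^+ 2 by exact: mulr_ge0 (exprn_ge0 k w0) (sqr_ge0 x).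
have h1 := sq0 0%N ((1 - 16 * w) * (1 - 4 * w)).
have h2 := sq0 1%N ((1 - 16 * w) * (1 - 4 * w)).
have h3 := sq0 1%N ((1 - 17 * w) * (1 - 2 * w)).
have h4 := sq0 1%N ((1 - 17 * w) * (1 - w)).
have h5 := sq0 1%N ((1 - 8 * w) * (1 - 16 * w)).
by rewrite /bvf_num; clear sq0; lra.
Qed.

Lemma dshear_num_gt0 w : 0 <= w -> 0 < dshear_num w.
Proof.
move=> w0; have h1 := sqr_ge0 (1 - 3 * w).
have h2 : 0 <= w ^+ 3 by rewrite exprn_ge0.
by rewrite /dshear_num; nra.
Qed.

(** This is [4 N^2 < U'^2] with denominators cleared. The listed products of squares and powers of
    [w] let [lra] write the difference, a polynomial of degree 8 with value 993 at 0, as a positive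
    combination. *)
Lemma richardson_num w : 0 <= w -> 32 * bvf_num w * tfac w ^+ 2
  < (dshear_num w * sfac w) ^+ 2.
Proof.
move=> w0.
have sq0 k x : 0 <= w ^+ k * x ^+ 2 by exact: mulr_ge0 (exprn_ge0 k w0) (sqr_ge0 x).
have h1 := sq0 1%N (1 - 6 * w).
have h2 := sq0 2%N (1 - 3 * w).
have h3 := sq0 2%N (1 - 4 * w).
have h4 := sq0 4%N (1 - w).
have h5 := sq0 6%N (1 - w).
have h6 := sq0 4%N 1.
have h7 := sq0 6%N 1.
have h8 := sq0 8%N 1.
by rewrite /dshear_num /sfac /tfac /bvf_num; clear sq0; lra.
Qed.

Lemma bvf_gt0 z : 0 < bvf z.
Proof.
have w0 := sqr_ge0 z.
by rewrite divr_gt0 ?mulr_gt0 ?exprn_gt0 ?bvf_num_gt0 ?tfac_gt0 ?sfac_gt0.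
Qed.

Lemma dshear_gt0 z : 0 < dshear z.
Proof.
have w0 := sqr_ge0 z.
by rewrite divr_gt0 ?exprn_gt0 ?dshear_num_gt0 ?tfac_gt0.
Qed.

Lemma richardson_lt z : bvf z / dshear z ^+ 2 < 1 / 4.
Proof.
have w0 := sqr_ge0 z.
have t0 := tfac_gt0 w0; have s0 := sfac_gt0 w0; have d0 := dshear_num_gt0 w0.
have -> : bvf z / dshear z ^+ 2 = (32 * bvf_num (z ^+ 2) * tfac (z ^+ 2) ^+ 2)
    / (dshear_num (z ^+ 2) * sfac (z ^+ 2)) ^+ 2 * (1 / 4).
  by rewrite /bvf /dshear; field; rewrite !gt_eqF.
rewrite gtr_pMl ?divr_gt0// ltr_pdivrMr ?exprn_gt0 ?mulr_gt0// mul1r.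
exact: richardson_num.
Qed.

Section ModeIdentities.
Variable w : R.
Hypothesis w0 : 0 <= w.

Let nz : [/\ tfac w != 0, sfac w != 0 & disc w != 0].
Proof. by rewrite !gt_eqF ?tfac_gt0 ?sfac_gt0 ?disc_gt0. Qed.

(** With [dphi_im_id], this is the equation [phi'' = omega] divided by [E]: the real part (further
    divided by [z]) and the imaginary part of the hydrostatic Taylor-Goldstein equation. *)
Lemma dphi_re_id : dphi_re w + phi_re w * growth w - phi_im w * rotation w
  = (1 - w) * om_re w.
Proof.
have [] := nz; rewrite /dphi_re /phi_re /phi_im /growth /rotation /om_re /om_im.
rewrite /disc /dshear_num /ddshear_num /bvf_num /shear_num /tfac /sfac.
by move=> ? ? ?; field; apply/and3P.
Qed.

Lemma dphi_im_id : dphi_im w + phi_re w * rotation w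
  + w * phi_im w * growth w = (1 - w) * om_im w.
Proof.
have [] := nz; rewrite /dphi_im /phi_re /phi_im /growth /rotation /om_im.
rewrite /disc /dshear_num /bvf_num /shear_num /tfac /sfac.
by move=> ? ? ?; field; apply/and3P.
Qed.

(** The right-hand side is the product rule applied to [(1 - w) (U - i) E]; the left-hand side comes
    from [phi' = (U' + f + i g) chi]. The second form has much smaller denominators and is the one
    that gets differentiated again. [phi_im_id] is the imaginary part, divided by [z]. *)
Lemma phi_re_id : phi_re w = - 2 * w * (shear_num w / tfac w ^+ 2)
  + (1 - w) * (dshear_num w / tfac w ^+ 3
               + w * (shear_num w / tfac w ^+ 2) * growth w + rotation w).
Proof.
have [] := nz; rewrite /phi_re /growth /rotation.
rewrite /disc /dshear_num /shear_num /tfac /sfac.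
by move=> ? ? ?; field; apply/and3P.
Qed.

Lemma phi_im_id : phi_im w =
  2 + (1 - w) * (shear_num w / tfac w ^+ 2 * rotation w - growth w).
Proof.
have [] := nz; rewrite /phi_im /growth /rotation.
rewrite /disc /shear_num /tfac /sfac.
by move=> ? ? ?; field; apply/and3P.
Qed.

Lemma om_im_id : (1 + w * (shear_num w / tfac w ^+ 2) ^+ 2) * om_im w =
  - (8 * bvf_num w / (tfac w ^+ 4 * sfac w ^+ 2)).
Proof.
have [] := nz; rewrite /om_im /disc.
by move=> ? ? ?; field; apply/and3P.
Qed.

Lemma om_im_lt0 : om_im w < 0.
Proof.
rewrite /om_im mulNr oppr_lt0.
by rewrite !(mulr_gt0, invr_gt0, exprn_gt0) ?bvf_num_gt0 ?tfac_gt0 ?sfac_gt0 ?disc_gt0.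
Qed.

End ModeIdentities.

Lemma is_derive_quotient (f g : R -> R) (x a b : R) : g x != 0 ->
  is_derive x 1 f a -> is_derive x 1 g b ->
  is_derive x 1 (fun y => f y / g y) ((a * g x - f x * b) / g x ^+ 2).
Proof.
move=> g0 fa gb; have gV := is_deriveV g0 gb.
by apply: is_derive_eq; rewrite /GRing.scale/=; field.
Qed.

Lemma is_derive_comp_sqr (f : R -> R) z a : is_derive (z ^+ 2) 1 f a ->
  is_derive z 1 (fun y => f (y ^+ 2)) (2 * z * a).
Proof.
move=> fa; have sq : is_derive z 1 (fun y : R => y ^+ 2) (2 * z).
  by apply: is_derive_eq; rewrite /GRing.scale/=; ring.
apply: is_derive_eq (@is_derive1_comp _ f (fun y => y ^+ 2) _ _ _ fa sq) _.
by rewrite mulrC.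
Qed.

Lemma is_derive_tfacX w n :
  is_derive w 1 (fun y => tfac y ^+ n) (2 * n%:R * tfac w ^+ n.-1).
Proof.
have dt : is_derive w 1 tfac 2.
  by rewrite /tfac; apply: is_derive_eq; rewrite /GRing.scale/=; ring.
rewrite (_ : (fun y => _) = tfac ^+ n); last by apply/funext => y; rewrite exprfctE.
by apply: is_derive_eq; rewrite /GRing.scale/=; ring.
Qed.

Lemma is_derive_sfac w : is_derive w 1 sfac 11.
Proof. by rewrite /sfac; apply: is_derive_eq; rewrite /GRing.scale/=; ring. Qed.

Lemma is_derive_shear_num w : is_derive w 1 shear_num (29 + 616 * w).
Proof.
by rewrite /shear_num; apply: is_derive_eq; rewrite /GRing.scale/=; ring.
Qed.

Lemma is_derive_dshear_num w :
  is_derive w 1 dshear_num (- 303 + 2964 * w + 1848 * w ^+ 2).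
Proof.
by rewrite /dshear_num; apply: is_derive_eq; rewrite /GRing.scale/=; ring.
Qed.

Lemma is_derive_shear z : is_derive z 1 shear (dshear z).
Proof.
have t0 : tfac (z ^+ 2) != 0 by rewrite gt_eqF// tfac_gt0// sqr_ge0.
have t20 : tfac (z ^+ 2) ^+ 2 != 0 by rewrite expf_neq0.
have dq := is_derive_comp_sqr
  (@is_derive_quotient _ (fun y => tfac y ^+ 2) _ _ _ t20
    (is_derive_shear_num _) (is_derive_tfacX _ 2)).
rewrite (_ : shear = (fun y => y * (shear_num (y ^+ 2) / tfac (y ^+ 2) ^+ 2))).
  apply: is_derive_eq; rewrite /dshear /GRing.scale/= {dq}.
  rewrite /dshear_num /shear_num /tfac in t0 *; by field.
by apply/funext => y; rewrite /shear mulrA.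
Qed.

Lemma is_derive_dshear z : is_derive z 1 dshear (ddshear z).
Proof.
have t0 : tfac (z ^+ 2) != 0 by rewrite gt_eqF// tfac_gt0// sqr_ge0.
have t30 : tfac (z ^+ 2) ^+ 3 != 0 by rewrite expf_neq0.
have dq := is_derive_comp_sqr
  (@is_derive_quotient _ (fun y => tfac y ^+ 3) _ _ _ t30
    (is_derive_dshear_num _) (is_derive_tfacX _ 3)).
apply: is_derive_eq dq _; rewrite /ddshear /=.
rewrite /ddshear_num /dshear_num /tfac in t0 *; by field.
Qed.

Lemma is_derive_phi_re z :
  is_derive z 1 (fun y => phi_re (y ^+ 2)) (z * dphi_re (z ^+ 2)).
Proof.
have t0 : tfac (z ^+ 2) != 0 by rewrite gt_eqF// tfac_gt0// sqr_ge0.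
have s0 : sfac (z ^+ 2) != 0 by rewrite gt_eqF// sfac_gt0// sqr_ge0.
have st0 : sfac (z ^+ 2) * tfac (z ^+ 2) != 0 by rewrite mulf_neq0.
have dst : is_derive (z ^+ 2) 1 (fun y => sfac y * tfac y) (13 + 44 * z ^+ 2).
  have ds := is_derive_sfac (z ^+ 2); have dt := is_derive_tfacX (z ^+ 2) 1.
  by apply: is_derive_eq; rewrite /sfac /tfac /GRing.scale/=; ring.
have dn : is_derive (z ^+ 2) 1 (fun y => 8 * (6 + 55 * y + 341 * y ^+ 2) : R)
    (8 * (55 + 682 * z ^+ 2)).
  by apply: is_derive_eq; rewrite /GRing.scale/=; ring.
have dq := is_derive_comp_sqr
  (@is_derive_quotient _ (fun y => sfac y * tfac y) _ _ _ st0 dn dst).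
have dU := is_derive_dshear z.
have sq : is_derive z 1 (fun y : R => 1 - y ^+ 2) (- (2 * z)).
  by apply: is_derive_eq; rewrite /GRing.scale/=; ring.
apply: is_derive_eq (is_deriveB (is_deriveM sq dU) dq) _.
rewrite /dphi_re /ddshear /dshear /GRing.scale/=.
by field; apply/andP.
Qed.

Lemma is_derive_phi_im z : is_derive z 1 (fun y => y * phi_im (y ^+ 2))
  (dphi_im (z ^+ 2)).
Proof.
have s0 : sfac (z ^+ 2) != 0 by rewrite gt_eqF// sfac_gt0// sqr_ge0.
have dt : is_derive (z ^+ 2) 1 (fun y => 8 * tfac y) 16.
  by rewrite /tfac; apply: is_derive_eq; rewrite /GRing.scale/=; ring.
have dq := is_derive_comp_sqr
  (@is_derive_quotient _ sfac _ _ _ s0 dt (is_derive_sfac _)).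
rewrite /phi_im; apply: is_derive_eq; rewrite /dphi_im /GRing.scale/=.
by rewrite /sfac /tfac in s0 *; field.
Qed.

End Profile.

(** * Smoothness of the profile and of the coefficients of the mode *)

Section SmoothProfile.
Context {R : realType}.

Lemma smooth_quotient (f g : R -> R) : (forall x, g x != 0) ->
  smooth f -> smooth g -> smooth (fun x => f x / g x).
Proof. by move=> g0 sf sg; apply: smoothM sf _; exact: smoothV. Qed.

(* The match is syntactic because unification would unfold numerals. *)
Ltac smooth_rational :=
  repeat lazymatch goal with
  | |- smooth (fun=> ?c) => exact: smooth_cst
  | |- smooth (fun x => x) => exact: smooth_id
  | |- smooth (fun x => _ + _) => apply: smoothD
  | |- smooth (fun x => - _) => apply: smoothN
  | |- smooth (fun x => _ ^+ _) => apply: smoothX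
  | |- smooth (fun x => _ * _) => apply: smoothM
  end.

Let sqr_neq0 (f : R -> R) z : (forall w, 0 <= w -> 0 < f w) -> f (z ^+ 2) != 0.
Proof. by move=> f0; rewrite gt_eqF// f0// sqr_ge0. Qed.

Lemma smooth_tfac : smooth (fun z : R => tfac (z ^+ 2)).
Proof. by rewrite /tfac; smooth_rational. Qed.

Lemma smooth_sfac : smooth (fun z : R => sfac (z ^+ 2)).
Proof. by rewrite /sfac; smooth_rational. Qed.

Lemma smooth_shear_num : smooth (fun z : R => shear_num (z ^+ 2)).
Proof. by rewrite /shear_num; smooth_rational. Qed.

Lemma smooth_bvf_num : smooth (fun z : R => bvf_num (z ^+ 2)).
Proof. by rewrite /bvf_num; smooth_rational. Qed.

Lemma smooth_disc : smooth (fun z : R => disc (z ^+ 2)).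
Proof.
apply: smoothD; first by apply: smoothX; exact: smooth_tfac.
by apply: smoothM; [smooth_rational|apply: smoothX; exact: smooth_shear_num].
Qed.

Lemma smooth_shear : smooth (@shear R).
Proof.
apply: smooth_quotient.
- by move=> z; rewrite expf_neq0// (sqr_neq0 z (@tfac_gt0 R)).
- by apply: smoothM; [exact: smooth_id|exact: smooth_shear_num].
- by apply: smoothX; exact: smooth_tfac.
Qed.

Lemma smooth_ddshear : smooth (@ddshear R).
Proof.
apply: smoothM; first exact: smooth_id.
apply: smooth_quotient.
- by move=> z; rewrite expf_neq0// (sqr_neq0 z (@tfac_gt0 R)).
- by rewrite /ddshear_num; smooth_rational.
- by apply: smoothX; exact: smooth_tfac.
Qed.

Lemma smooth_bvf : smooth (@bvf R).
Proof.
apply: smooth_quotient.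
- move=> z; rewrite mulf_neq0 ?expf_neq0//.
    exact: sqr_neq0 z (@tfac_gt0 R).
  exact: sqr_neq0 z (@sfac_gt0 R).
- by apply: smoothM; [exact: smooth_cst|exact: smooth_bvf_num].
- by apply: smoothM; apply: smoothX; [exact: smooth_tfac|exact: smooth_sfac].
Qed.

Let sfac_disc_neq0 z : sfac (z ^+ 2) * disc (z ^+ 2) != 0 :> R.
Proof. by rewrite mulf_neq0 ?(sqr_neq0 z (@sfac_gt0 R)) ?(sqr_neq0 z (@disc_gt0 R)). Qed.

Lemma smooth_growth : smooth (fun z : R => z * growth (z ^+ 2)).
Proof.
apply: smoothM; first exact: smooth_id.
apply: smooth_quotient => //; last first.
  by apply: smoothM; [exact: smooth_sfac|exact: smooth_disc].
apply: smoothM; first exact: smooth_cst.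
apply: smoothD.
  by apply: smoothM; [exact: smooth_cst|apply: smoothX; exact: smooth_tfac].
by apply: smoothM; [exact: smooth_shear_num|smooth_rational].
Qed.

Lemma smooth_rotation : smooth (fun z : R => rotation (z ^+ 2)).
Proof.
apply: smooth_quotient => //; last first.
  by apply: smoothM; [exact: smooth_sfac|exact: smooth_disc].
by apply: smoothM; [smooth_rational|apply: smoothX; exact: smooth_tfac].
Qed.

Lemma smooth_om_im : smooth (fun z : R => om_im (z ^+ 2)).
Proof.
apply: smoothM; first by apply: smoothN; exact: smooth_bvf.
apply: smooth_quotient; last exact: smooth_disc.
- by move=> z; exact: sqr_neq0 (@disc_gt0 R).
- by apply: smoothX; exact: smooth_tfac.
Qed.

Lemma smooth_om_re : smooth (fun z : R => z * om_re (z ^+ 2)).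
Proof.
rewrite (_ : (fun z => _) = fun z => ddshear z + shear z * om_im (z ^+ 2)).
  apply: smoothD; first exact: smooth_ddshear.
  by apply: smoothM; [exact: smooth_shear|exact: smooth_om_im].
by apply/funext => z; rewrite /om_re /ddshear /shear; ring.
Qed.

End SmoothProfile.

(** * Normal modes with [c = i] *)

Section NormalMode.
Context {R : realType}.
Variables U N ddU : R -> R.

(* (r1 + i r2, o1 + i o2, p1 + i p2) are the z-profiles of the density, the
   vorticity and the stream function of a normal mode with c = i:
   (U - i) r = - N p, (U - i) o = U'' p + r and p'' = o. *)
Record normal_mode (r1 r2 o1 o2 p1 p2 : R -> R) : Prop := NormalMode {
  mode_smooth : [/\ smooth r1, smooth r2, smooth o1 & smooth o2] ;
  mode_stream : [/\ smooth p1, smooth p2,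
    (exists2 q, forall z : R, is_derive z 1 p1 (q z) &
                forall z : R, is_derive z 1 q (o1 z)) &
    (exists2 q, forall z : R, is_derive z 1 p2 (q z) &
                forall z : R, is_derive z 1 q (o2 z))] ;
  mode_wall : [/\ p1 (-1) = 0, p1 1 = 0, p2 (-1) = 0 & p2 1 = 0] ;
  mode_eq : forall z, [/\ r1 z = U z * r2 z + N z * p2 z,
    r2 z = - (U z * r1 z + N z * p1 z),
    o1 z = U z * o2 z - ddU z * p2 z - r2 z &
    o2 z = - (U z * o1 z - ddU z * p1 z - r1 z)] }.

(** The trivial mode is the competitor of the explicit one when uniqueness of the resolvent problem
    is refuted. *)
Lemma normal_mode0 : normal_mode (fun=> 0) (fun=> 0) (fun=> 0) (fun=> 0)
  (fun=> 0) (fun=> 0).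
Proof.
have s0 := @smooth_cst R 0; split => //.
- by split=> //; exists (fun=> 0) => z; exact: is_derive_cst.
- by move=> z; split; ring.
Qed.

End NormalMode.

(** * The explicit mode *)

Section ExplicitMode.
Context {R : realType}.
Variables lam1 lam2 : R -> R.
Hypothesis dlam1 : forall z : R, is_derive z 1 lam1 (z * growth (z ^+ 2)).
Hypothesis dlam2 : forall z : R, is_derive z 1 lam2 (rotation (z ^+ 2)).

(** [ecos + i esin] is the factor [E = e^(lam1 + i lam2)] of [chi]. *)
Definition ecos z := expR (lam1 z) * cos (lam2 z).
Definition esin z := expR (lam1 z) * sin (lam2 z).

Let slam1 : smooth lam1.
Proof. exact: smooth_antiderivative dlam1 (@smooth_growth R). Qed.

Let slam2 : smooth lam2.
Proof. exact: smooth_antiderivative dlam2 (@smooth_rotation R). Qed.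

Lemma smooth_ecos : smooth ecos.
Proof. by apply: smoothM; [exact: smooth_expR|exact: smooth_cos]. Qed.

Lemma smooth_esin : smooth esin.
Proof. by apply: smoothM; [exact: smooth_expR|exact: smooth_sin]. Qed.

Lemma is_derive_ecos (z : R) : is_derive z 1 ecos
  (z * growth (z ^+ 2) * ecos z - rotation (z ^+ 2) * esin z).
Proof.
have d1 := dlam1 z; have d2 := dlam2 z.
have de := @is_derive1_comp _ expR _ _ _ _ (is_derive_expR _) d1.
have dc := @is_derive1_comp _ cos _ _ _ _ (is_derive_cos _) d2.
apply: is_derive_eq (is_deriveM de dc) _.
by rewrite /ecos /esin /GRing.scale/=; ring.
Qed.

Lemma is_derive_esin (z : R) : is_derive z 1 esin
  (z * growth (z ^+ 2) * esin z + rotation (z ^+ 2) * ecos z).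
Proof.
have d1 := dlam1 z; have d2 := dlam2 z.
have de := @is_derive1_comp _ expR _ _ _ _ (is_derive_expR _) d1.
have ds := @is_derive1_comp _ sin _ _ _ _ (is_derive_sin _) d2.
apply: is_derive_eq (is_deriveM de ds) _.
by rewrite /ecos /esin /GRing.scale/=; ring.
Qed.

(** For [chi = (1 - z^2) E] the stream function is [(U - i) chi], so the mode equations force the
    density [- N^2 chi] and the vorticity [(U'' - N^2 / (U - i)) chi]. *)
Lemma explicit_normal_mode : normal_mode shear bvf ddshear
  (fun z => - bvf z * (1 - z ^+ 2) * ecos z)
  (fun z => - bvf z * (1 - z ^+ 2) * esin z)
  (fun z => (1 - z ^+ 2) * (z * om_re (z ^+ 2) * ecos z - om_im (z ^+ 2) * esin z))
  (fun z => (1 - z ^+ 2) * (z * om_re (z ^+ 2) * esin z + om_im (z ^+ 2) * ecos z))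
  (fun z => (1 - z ^+ 2) * (shear z * ecos z + esin z))
  (fun z => (1 - z ^+ 2) * (shear z * esin z - ecos z)).
Proof.
have sc := smooth_ecos; have ss := smooth_esin; have sU := @smooth_shear R.
have sN := @smooth_bvf R; have s1 := @smooth_om_re R; have s2 := @smooth_om_im R.
have s1w : smooth (fun z : R => 1 - z ^+ 2).
  by apply: smoothB; [exact: smooth_cst|apply: smoothX; exact: smooth_id].
have sNw : smooth (fun z : R => - bvf z * (1 - z ^+ 2)).
  by apply: smoothM => //; exact: smoothN.
have dw (z : R) : is_derive z 1 (fun y : R => 1 - y ^+ 2) (- (2 * z)).
  by apply: is_derive_eq; rewrite /GRing.scale/=; ring.
split.
- split; [exact: smoothM|exact: smoothM|apply: smoothM => //|apply: smoothM => //].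
    by apply: smoothB; exact: smoothM.
  by apply: smoothD; exact: smoothM.
- split.
  + by apply: smoothM => //; apply: smoothD => //; exact: smoothM.
  + by apply: smoothM => //; apply: smoothB => //; exact: smoothM.
  + exists (fun z => phi_re (z ^+ 2) * ecos z - z * phi_im (z ^+ 2) * esin z) => z.
      have dC := is_derive_ecos z; have dS := is_derive_esin z.
      have dU := is_derive_shear z; have dwz := dw z.
      apply: is_derive_eq; rewrite /GRing.scale/=.
      rewrite phi_re_id ?phi_im_id ?sqr_ge0// /shear /dshear; ring.
    have dC := is_derive_ecos z; have dS := is_derive_esin z.
    have dP := is_derive_phi_re z; have dQ := is_derive_phi_im z.
    apply: is_derive_eq; rewrite /GRing.scale/=.
    have := dphi_re_id (sqr_ge0 z); have := dphi_im_id (sqr_ge0 z).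
    set w := z ^+ 2 => E1 E2.
    rewrite [RHS](_ : _ = z * ((1 - w) * om_re w) * ecos z - (1 - w) * om_im w * esin z).
      by rewrite -E1 -E2 /w; ring.
    by ring.
  + exists (fun z => phi_re (z ^+ 2) * esin z + z * phi_im (z ^+ 2) * ecos z) => z.
      have dC := is_derive_ecos z; have dS := is_derive_esin z.
      have dU := is_derive_shear z; have dwz := dw z.
      apply: is_derive_eq; rewrite /GRing.scale/=.
      rewrite phi_re_id ?phi_im_id ?sqr_ge0// /shear /dshear; ring.
    have dC := is_derive_ecos z; have dS := is_derive_esin z.
    have dP := is_derive_phi_re z; have dQ := is_derive_phi_im z.
    apply: is_derive_eq; rewrite /GRing.scale/=.
    have := dphi_re_id (sqr_ge0 z); have := dphi_im_id (sqr_ge0 z).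
    set w := z ^+ 2 => E1 E2.
    rewrite [RHS](_ : _ = z * ((1 - w) * om_re w) * esin z + (1 - w) * om_im w * ecos z).
      by rewrite -E1 -E2 /w; ring.
    by ring.
- by split; rewrite ?sqrrN expr1n subrr mul0r.
(* Writing [N^2] as [- (1 + U^2) om_im] removes all quotients, and the four equations become
   polynomial identities. *)
- move=> z; have := om_im_id (sqr_ge0 z).
  rewrite -/(bvf z) => E; have {}E : bvf z = - ((1 + shear z ^+ 2) * om_im (z ^+ 2)).
    by rewrite /bvf -[LHS]opprK -E /shear; ring.
  have E1 : z * om_re (z ^+ 2) = ddshear z + shear z * om_im (z ^+ 2).
    by rewrite /om_re /ddshear /shear; ring.
  by rewrite E1 E; split; ring.
Qed.

End ExplicitMode.

(** * Growing modes *)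

Section Waves.
Context {R : realType}.
Implicit Types (a b x z t kap : R) (k : int).

Lemma cosD2pik x k : cos (x + k%:~R * (2 * pi)) = cos x.
Proof.
have pi2 n : n%:R * (2 * pi) = pi *+ 2 *+ n :> R by rewrite mulr_natl mulr_natl.
case: k => n; first by rewrite -pmulrn pi2 (periodicn (@cosD2pi R)).
rewrite NegzE mulrNz mulNr -pmulrn pi2 -[in RHS](subrK (pi *+ 2 *+ n.+1) x).
by rewrite (periodicn (@cosD2pi R)).
Qed.

Lemma sinD2pik x k : sin (x + k%:~R * (2 * pi)) = sin x.
Proof. by rewrite -!cosBpihalf addrAC cosD2pik. Qed.

(** The real part of [(a + i b) e^(i kap x)]. *)
Definition wave kap a b x := a * cos (kap * x) - b * sin (kap * x).

Lemma wave_periodic k a b x : wave k%:~R a b (x + 2 * pi) = wave k%:~R a b x.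
Proof. by rewrite /wave mulrDr cosD2pik sinD2pik. Qed.

Lemma is_derive_wave kap a b x :
  is_derive x 1 (wave kap a b) (- kap * wave kap b (- a) x).
Proof.
have dk : is_derive x 1 (fun y : R => kap * y) kap.
  by apply: is_derive_eq; rewrite /GRing.scale/=; ring.
have dc := @is_derive1_comp _ cos _ _ _ _ (is_derive_cos _) dk.
have ds := @is_derive1_comp _ sin _ _ _ _ (is_derive_sin _) dk.
have : is_derive x 1 (fun y => a * cos (kap * y) - b * sin (kap * y))
    (- kap * wave kap b (- a) x).
  by apply: is_derive_eq; rewrite /wave /GRing.scale/=; ring.
by [].
Qed.

Lemma polar_wave kap a b r th x t : r * cos th = a -> r * sin th = - b ->
  r * expR (kap * 1 * t) * cos (kap * (x - 0 * t) - th) =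
  expR (kap * t) * wave kap a b x.
Proof.
move=> <- rb; rewrite mulr1 mul0r subr0 cosB /wave.
have -> : b = - (r * sin th) by rewrite rb opprK.
by ring.
Qed.

Variables rho_s U_s N ddU : R -> R.
Hypothesis drho_s : forall z, rho_s^`()%classic z = - N z.
Hypothesis ddU_s : forall z, U_s^`(2)%classic z = ddU z.
Variables r1 r2 o1 o2 p1 p2 : R -> R.
Hypothesis mode : normal_mode U_s N ddU r1 r2 o1 o2 p1 p2.

(** Since [- i k c = k], the time derivative multiplies a wave by [k], while the [x] derivative
    multiplies its complex amplitude by [i k]; what remains is [mode_eq] at each [z]. The minus
    signs in the sine hypotheses come from the phases being subtracted. *)
Lemma normal_mode_classical (r th1 w th2 : R -> R) k :
  (forall z, r z * cos (th1 z) = r1 z) -> (forall z, r z * sin (th1 z) = - r2 z) ->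
  (forall z, w z * cos (th2 z) = o1 z) -> (forall z, w z * sin (th2 z) = - o2 z) ->
  classical_solution rho_s U_s
    (fun t x z => r z * expR (k%:~R * 1 * t) * cos (k%:~R * (x - 0 * t) - th1 z))
    (fun t x z => w z * expR (k%:~R * 1 * t) * cos (k%:~R * (x - 0 * t) - th2 z)).
Proof.
move=> rc rs wc ws.
pose rho t x z := expR (k%:~R * t) * wave k%:~R (r1 z) (r2 z) x.
pose om t x z := expR (k%:~R * t) * wave k%:~R (o1 z) (o2 z) x.
rewrite (_ : (fun t x z => r z * _ * _) = rho); last first.
  by do 3!apply/funext => ?; exact: polar_wave.
rewrite (_ : (fun t x z => w z * _ * _) = om); last first.
  by do 3!apply/funext => ?; exact: polar_wave.
split; first by move=> t x z; rewrite /rho /om !wave_periodic.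
pose phi t x z := expR (k%:~R * t) * wave k%:~R (p1 z) (p2 z) x.
exists phi; split.
  move=> t x; have [sp1 sp2 [q1 dp1 dq1] [q2 dp2 dq2]] := mode_stream mode.
  have dphi z : is_derive z 1 (phi t x) (expR (k%:~R * t) * wave k%:~R (q1 z) (q2 z) x).
    rewrite /phi /wave; have d1 := dp1 z; have d2 := dp2 z.
    by apply: is_derive_eq; rewrite /GRing.scale/=; ring.
  have [p1N p1P p2N p2P] := mode_wall mode; split.
  - apply: continuous_subspaceT => z; apply/differentiable_continuous/derivable1_diffP.
    by case: (dphi z).
  - by rewrite /phi p1N p2N /wave !mul0r subrr mulr0.
  - by rewrite /phi p1P p2P /wave !mul0r subrr mulr0.
  - move=> z _; split; first by case: (dphi z).
    rewrite (_ : _^`()%classic = fun z => expR (k%:~R * t) * wave k%:~R (q1 z) (q2 z) x).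
      rewrite /om /wave; have d1 := dq1 z; have d2 := dq2 z.
      by apply: is_derive_eq; rewrite /GRing.scale/=; ring.
    by apply/funext => y; rewrite derive1E; case: (dphi y).
move=> t x z _; have [E1 E2 E3 E4] := mode_eq mode z.
pose dx a b := expR (k%:~R * t) * (- k%:~R * wave k%:~R b (- a) x).
have dxP a b : is_derive x 1 (fun y => expR (k%:~R * t) * wave k%:~R a b y) (dx a b).
  have dw := is_derive_wave k%:~R a b x.
  by apply: is_derive_eq; rewrite /dx /GRing.scale/=; ring.
have dtP a b : is_derive t 1 (fun s => expR (k%:~R * s) * wave k%:~R a b x)
    (k%:~R * expR (k%:~R * t) * wave k%:~R a b x).
  have dk : is_derive t 1 (fun y : R => k%:~R * y) k%:~R.
    by apply: is_derive_eq; rewrite /GRing.scale/=; ring.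
  have de := @is_derive1_comp _ expR _ _ _ _ (is_derive_expR _) dk.
  by apply: is_derive_eq; rewrite /GRing.scale/=; ring.
exists (dx (r1 z) (r2 z)), (dx (o1 z) (o2 z)), (dx (p1 z) (p2 z)).
split; [exact: dxP|exact: dxP|exact: dxP| |].
- apply: is_derive_eq (dtP (r1 z) (r2 z)) _; rewrite drho_s /dx.
  transitivity (k%:~R * expR (k%:~R * t) * wave k%:~R
    (U_s z * r2 z + N z * p2 z) (- (U_s z * r1 z + N z * p1 z)) x).
    by rewrite -E1 -E2.
  by rewrite /wave; ring.
- apply: is_derive_eq (dtP (o1 z) (o2 z)) _; rewrite ddU_s /dx.
  transitivity (k%:~R * expR (k%:~R * t) * wave k%:~R
    (U_s z * o2 z - ddU z * p2 z - r2 z) (- (U_s z * o1 z - ddU z * p1 z - r1 z)) x).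
    by rewrite -E3 -E4.
  by rewrite /wave; ring.
Qed.

End Waves.

(** * The operator on L^2 *)

Section Plane.
Context {R : realType}.
Local Notation mu := (@lebesgue_measure R).
Local Notation mu2 := (@mu2 R).
Local Notation Omega := (@Omega R).

(** An open set is the union of the countably many rational squares that it contains. This makes
    continuous functions measurable for the product sigma-algebra carrying [mu2]. *)
Lemma open_plane_measurable (O : set (R * R)) : open O -> measurable O.
Proof.
move=> oO; pose box (q r e : rat) : set (R * R) :=
  `]ratr q - ratr e, ratr q + ratr e[ `*` `]ratr r - ratr e, ratr r + ratr e[.
(* Squares that leave [O] are replaced by the empty set, so the union can range over all rational
   triples. *)
pose S q r e := if pselect (box q r e `<=` O) then box q r e else set0.
have -> : O = \bigcup_q \bigcup_r \bigcup_e S q r e.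
  apply/seteqP; split => [[x z] Oxz|p [q _ [r _ [e _]]]]; last first.
    by rewrite /S; case: pselect => [sb /sb|_ []].
  have /nbhs_ballP[d /= d0 dO] := open_nbhs_nbhs (conj oO Oxz).
  have [e] : exists e : rat, ratr e \in `]0, d / 2[.
    by apply: rat_in_itvoo; rewrite divr_gt0.
  rewrite in_itv/= => /andP[e0 ed].
  have center (y : R) : exists q : rat, `|y - ratr q| < ratr e.
    have [q] : exists q : rat, ratr q \in `]y, y + ratr e[.
      by apply: rat_in_itvoo; rewrite ltrDl.
    rewrite in_itv/= => /andP[yq qy]; exists q.
    by rewrite distrC ger0_norm ?subr_ge0 ?(ltW yq)// ltrBlDl.
  have [q xq] := center x; have [r zr] := center z.
  exists q => //; exists r => //; exists e => //; rewrite /S.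
  have inbox (y : R) (c : rat) :
      `]ratr c - ratr e, ratr c + ratr e[%classic y <-> `|y - ratr c| < ratr e.
    by rewrite /= in_itv/= ltr_distl.
  case: pselect => [sb|nsb]; first by split; exact/inbox.
  case: nsb => -[x' z'] [/inbox x'q /inbox z'r]; apply: dO; split => /=.
    rewrite /ball/= (le_lt_trans (ler_distD (ratr q) _ _))//.
    by move: xq x'q; rewrite [`|ratr q - _|]distrC; lra.
  rewrite /ball/= (le_lt_trans (ler_distD (ratr r) _ _))//.
  by move: zr z'r; rewrite [`|ratr r - _|]distrC; lra.
do 3!(apply: bigcupT_measurable_rat => ?); rewrite /S.
case: pselect => [sb|nsb]; last exact: measurable0.
exact: measurableX.
Qed.

Lemma continuous_plane_measurable (f : R * R -> R) (A : set (R * R)) :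
  measurable A -> continuous f -> measurable_fun A f.
Proof.
move=> mA cf; apply: (measurability _ (measurable_realfun.RGenOInfty.measurableE R)) => //.
move=> /= _ [_ [x ->] <-]; apply: measurableI => //; apply: open_plane_measurable.
by apply: open_comp => // p _; exact: cf.
Qed.

Lemma measurable_Omega : measurable Omega.
Proof. exact: measurableX. Qed.

Lemma mu2_Omega : mu2 Omega = (2 * pi * 2)%:E.
Proof.
transitivity (mu `]0%R, (2 * pi)%R[%classic * mu `](-1)%R, 1%R[%classic)%E.
  exact: product_measure1E.
rewrite !lebesgue_measure_itv/= !lte_fin.
have pi0 := @pi_gt0 R.
rewrite (_ : 0 < 2 * pi)%R; last by lra.
rewrite (_ : -1 < 1 :> R)%R; last by lra.
by rewrite -!EFinD -EFinM; congr EFin; lra.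
Qed.

Lemma mu2_Omega_lty : (mu2 Omega < +oo)%E.
Proof. by rewrite mu2_Omega ltry. Qed.

Lemma continuous_bounded_Omega (f : R * R -> R) : continuous f ->
  [bounded f p | p in Omega].
Proof.
move=> cf.
have cK : compact (`[0, 2 * pi] `*` `[-1, 1] : set (R * R)).
  by apply: compact_setX; exact: segment_compact.
have : bounded_set [set f x | x in (`[0, 2 * pi] `*` `[-1, 1] : set (R * R))].
  by apply/compact_bounded/continuous_compact => //; exact: continuous_subspaceT.
move=> [M [Mreal fM]]; exists M; split=> // y My p [px pz].
apply: (fM y My); exists p => //.
by split; apply: subset_itv_oo_cc.
Qed.

Lemma continuous_integrable_Omega (f : R * R -> R) : continuous f ->
  mu2.-integrable Omega (EFin \o f).
Proof.
move=> cf; apply: measurable_bounded_integrable.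
- exact: measurable_Omega.
- exact: mu2_Omega_lty.
- by apply: continuous_plane_measurable => //; exact: measurable_Omega.
- exact: continuous_bounded_Omega.
Qed.

Lemma continuous_L2 (f : R * R -> R) : continuous f -> L2 f.
Proof.
move=> cf; split.
  by apply: continuous_plane_measurable => //; exact: measurable_Omega.
have cf2 : continuous (fun p => f p ^+ 2).
  rewrite (_ : (fun p => _) = f \* f); last by apply/funext => p; rewrite expr2.
  by move=> p; exact: (continuousM (cf p) (cf p)).
exact: (@integrable_lty _ _ _ mu2 _ measurable_Omega _ (continuous_integrable_Omega cf2)).
Qed.

(** Fubini reduces the weak formulation to integrals in [x] at fixed [z], where integration by parts
    is one-dimensional. *)
Lemma eq_integral_Omega (f g : R * R -> R) : continuous f -> continuous g ->
  (forall z : R, \int[mu]_(x in `]0%R, (2 * pi)%R[) (f (x, z))%:E =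
                 \int[mu]_(x in `]0%R, (2 * pi)%R[) (g (x, z))%:E)%E ->
  \int[mu2]_(p in Omega) f p = \int[mu2]_(p in Omega) g p.
Proof.
move=> cf cg fg; rewrite /Rintegral; congr fine.
have slices (h : R * R -> R) : continuous h ->
    (\int[mu2]_(p in Omega) (h p)%:E =
     \int[mu]_(z in `](-1)%R, 1%R[) \int[mu]_(x in `]0%R, (2 * pi)%R[) (h (x, z))%:E)%E.
  move=> ch; rewrite integral_mkcond.
  have iH : (mu \x mu)%E.-integrable setT ((fun p => (h p)%:E) \_ Omega).
    apply/integrable_restrict => //; first exact: measurable_Omega.
    by rewrite setTI; exact: continuous_integrable_Omega.
  rewrite -(integral21_prod_meas1 iH) [RHS]integral_mkcond.
  apply: eq_integral => z _; rewrite /fubini_G patchE; case: ifPn => zI.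
    rewrite [RHS]integral_mkcond; apply: eq_integral => x _; rewrite !patchE.
    by rewrite /Omega in_setX /= zI andbT.
  apply: integral0_eq => x _; rewrite patchE /Omega in_setX /= (negbTE zI).
  by rewrite andbF.
by rewrite !slices//; apply: eq_integral => z _; exact: fg.
Qed.

End Plane.

(** * Plane waves in the weak formulation *)

Section NormalModeGraph.
Context {R : realType}.
Local Notation mu := (@lebesgue_measure R).
Implicit Types (a b : R -> R) (k : int).

Lemma continuous_mul (T : topologicalType) (f g : T -> R) :
  continuous f -> continuous g -> continuous (fun x => f x * g x).
Proof. by move=> cf cg x; exact: (continuousM (cf x) (cg x)). Qed.

Lemma continuous_scale (T : topologicalType) (c : R) (f : T -> R) :
  continuous f -> continuous (fun x => c * f x).
Proof. by move=> cf; apply: continuous_mul cf; exact: cst_continuous. Qed.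

Lemma continuous_pair (f g : R -> R) :
  continuous f -> continuous g -> continuous (fun x => (f x, g x)).
Proof.
move=> cf cg x.
exact: (@cvg_pair _ _ _ (nbhs x) (nbhs (f x)) (nbhs (g x)) _ _ _ f g (cf x) (cg x)).
Qed.

Lemma derivable_LRcontinuous (f : R -> R) (x y : R) :
  (forall z : R, derivable f z 1) -> derivable_oo_LRcontinuous f x y.
Proof.
move=> df; have cf : continuous f.
  by move=> z; exact/differentiable_continuous/derivable1_diffP.
split; first by move=> z _; exact: df.
- exact/cvg_at_right_filter/cf.
- exact/cvg_at_left_filter/cf.
Qed.

Lemma integral_itvoo (f : R -> R) (x y : R) : continuous f ->
  (\int[mu]_(t in `]x, y[) (f t)%:E = (\int[mu]_(t in `[x, y]) f t)%R%:E)%E.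
Proof.
move=> cf; have icc := continuous_integrable_itv x y cf.
have ico : mu.-integrable `[x, y[ (EFin \o f).
  by apply: integrableS icc => //; exact: subset_itv_co_cc.
have ioo : mu.-integrable `]x, y[ (EFin \o f).
  by apply: integrableS icc => //; exact: subset_itv_oo_cc.
rewrite -Rintegral_itv_bndo_bndc// -Rintegral_itv_obnd_cbnd//.
by rewrite /Rintegral fineK//; exact: integrable_fin_num.
Qed.

Lemma FTC_itvoo (f F : R -> R) (x y : R) : x < y -> continuous f ->
  (forall z : R, is_derive z 1 F (f z)) ->
  F y = F x + \int[mu]_(t in `]x, y[) f t.
Proof.
move=> xy cf dF; rewrite /Rintegral integral_itvoo//= /Rintegral.
rewrite (@continuous_FTC2 _ f F)//=; first by ring.
- exact: continuous_subspaceT.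
- by apply: derivable_LRcontinuous => z; case: (dF z).
- by move=> z _; rewrite derive1E; case: (dF z).
Qed.

Definition plane_wave k a b (p : R * R) := wave k%:~R (a p.2) (b p.2) p.1.

Lemma continuous_plane_wave k a b : continuous a -> continuous b ->
  continuous (plane_wave k a b).
Proof.
move=> ca cb.
have cc : continuous (fun p : R * R => cos (k%:~R * p.1)).
  move=> p; apply: (@continuous_comp _ _ _ (fun p : R * R => k%:~R * p.1) cos);
    last exact: continuous_cos.
  by apply: continuousM; [exact: cvg_cst|exact: cvg_fst].
have cs : continuous (fun p : R * R => sin (k%:~R * p.1)).
  move=> p; apply: (@continuous_comp _ _ _ (fun p : R * R => k%:~R * p.1) sin);
    last exact: continuous_sin.
  by apply: continuousM; [exact: cvg_cst|exact: cvg_fst].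
have c2 (f : R -> R) : continuous f -> continuous (fun p : R * R => f p.2).
  move=> cf p; apply: (@continuous_comp _ _ _ (fun p : R * R => p.2) f); last exact: cf.
  exact: cvg_snd.
move=> p; have h1 := continuousM (c2 a ca p) (cc p).
have h2 := continuousM (c2 b cb p) (cs p).
have h3 := continuousB h1 h2.
exact: h3.
Qed.

Lemma is_derive_slice (psi : R * R -> R) (x z : R) :
  derivable psi (x, z) (1, 0) ->
  is_derive x 1 (fun y => psi (y, z)) ('D_((1, 0) : R * R) psi (x, z)).
Proof.
have E : (fun h : R => h^-1 *: (psi (h *: ((1, 0) : R * R) + (x, z)) - psi (x, z))) =
         (fun h : R => h^-1 *: (psi (h *: (1 : R) + x, z) - psi (x, z))).
  apply/funext => h; congr (_ *: (psi _ - _)).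
  by congr pair; rewrite /= scaler0 add0r.
move=> d; apply: DeriveDef.
  by move: d; rewrite /derivable E.
by rewrite /derive E.
Qed.

(** The [x] derivative of the wave on the right is [- k] times the wave on the left; the boundary
    terms at 0 and [2 pi] cancel by periodicity. *)
Lemma plane_wave_by_parts k a b (psi : R * R -> R) : continuous a -> continuous b ->
  test_function psi ->
  \int[mu2]_(p in @Omega R) (k%:~R * plane_wave k a b p * psi p) =
  \int[mu2]_(p in @Omega R)
    (plane_wave k (fun z => - b z) a p * 'D_((1, 0) : R * R) psi p).
Proof.
move=> ca cb [spsi per _].
have [/= cpsi dpsi] := spsi [::].
have [/= cDpsi _] := spsi [:: (1, 0)].
have cNb : continuous (fun z => - b z) by move=> z; apply: continuousN; exact: cb.
have cw := @continuous_plane_wave k _ _ ca cb.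
have cw' := @continuous_plane_wave k _ _ cNb ca.
have cl : continuous (fun p => k%:~R * plane_wave k a b p * psi p).
  by apply: continuous_mul cpsi; exact: continuous_scale.
have cr : continuous
    (fun p => plane_wave k (fun z => - b z) a p * 'D_((1, 0) : R * R) psi p).
  exact: continuous_mul.
apply: eq_integral_Omega => // z.
have slice (f : R * R -> R) : continuous f -> continuous (fun x => f (x, z)).
  move=> cf x; apply: (@continuous_comp _ _ _ (fun x => (x, z)) f); last exact: cf.
  by apply: continuous_pair; [move=> ?; exact: cvg_id|exact: cst_continuous].
rewrite !integral_itvoo; [|exact: slice cr|exact: slice cl]; congr EFin.
have pi0 : 0 < 2 * pi :> R by rewrite mulr_gt0 ?pi_gt0.
pose F := wave k%:~R (- b z) (a z).
pose f x := - k%:~R * wave k%:~R (a z) (b z) x.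
have dF (x : R) : is_derive x 1 F (f x).
  by apply: is_derive_eq (is_derive_wave _ _ _ _) _; rewrite opprK.
have dG (x : R) : is_derive x 1 (fun y => psi (y, z)) ('D_((1, 0) : R * R) psi (x, z)).
  by apply: is_derive_slice; exact: dpsi.
have cf : continuous f.
  by apply: continuous_scale; exact: (slice _ cw).
have := @Rintegration_by_parts _ F (fun x => psi (x, z)) f
  (fun x => 'D_((1, 0) : R * R) psi (x, z)) 0 (2 * pi) pi0.
move=> ->.
- have -> : F (2 * pi) * psi (2 * pi, z) = F 0 * psi (0, z).
    by rewrite -[2 * pi]add0r /F wave_periodic per.
  rewrite subrr sub0r -mulN1r -RintegralZl//.
    by apply: eq_Rintegral => x _; rewrite /f /plane_wave/=; ring.
  apply: continuous_integrable_itv; apply: continuous_mul; first exact: cf.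
  exact: (slice _ cpsi).
- exact: continuous_subspaceT.
- by apply: derivable_LRcontinuous => x; case: (dF x).
- by move=> x _; rewrite derive1E; case: (dF x).
- by apply: continuous_subspaceT; exact: (slice _ cDpsi).
- by apply: derivable_LRcontinuous => x; case: (dG x).
- by move=> x _; rewrite derive1E; case: (dG x).
Qed.

Variables rho_s U_s N ddU : R -> R.
Hypothesis drho_s : forall z, rho_s^`()%classic z = - N z.
Hypothesis ddU_s : forall z, U_s^`(2)%classic z = ddU z.

(** After integration by parts, [k r] is tested as [i r] against the [x] derivative of [psi]. The
    mode equations in the form [i r = U r + N p] and [i o = U o - U'' p - r] give exactly the fluxes
    in the definition of the graph. *)
Lemma normal_mode_graphR r1 r2 o1 o2 p1 p2 k :
  normal_mode U_s N ddU r1 r2 o1 o2 p1 p2 ->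
  hydro_graphR rho_s U_s (plane_wave k r1 r2, plane_wave k o1 o2)
    (fun p => k%:~R * plane_wave k r1 r2 p, fun p => k%:~R * plane_wave k o1 o2 p).
Proof.
move=> [[sr1 sr2 so1 so2] [sp1 sp2 [q1 dp1 dq1] [q2 dp2 dq2]] [p1N p1P p2N p2P] E].
have cr := @continuous_plane_wave k _ _ (smooth_continuous sr1) (smooth_continuous sr2).
have co := @continuous_plane_wave k _ _ (smooth_continuous so1) (smooth_continuous so2).
have cp := @continuous_plane_wave k _ _ (smooth_continuous sp1) (smooth_continuous sp2).
split; [exact: continuous_L2|exact: continuous_L2|
  by apply: continuous_L2; exact: continuous_scale|
  by apply: continuous_L2; exact: continuous_scale|].
exists (plane_wave k p1 p2); split.
  split; first exact: continuous_L2.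
  apply: aeW => x _; rewrite /plane_wave /=.
  have dphi (z : R) : is_derive z 1 (fun y => wave k%:~R (p1 y) (p2 y) x)
      (wave k%:~R (q1 z) (q2 z) x).
    rewrite /wave; have d1 := dp1 z; have d2 := dp2 z.
    by apply: is_derive_eq; rewrite /GRing.scale/=; ring.
  have ddphi (z : R) : is_derive z 1 (fun y => wave k%:~R (q1 y) (q2 y) x)
      (wave k%:~R (o1 z) (o2 z) x).
    rewrite /wave; have d1 := dq1 z; have d2 := dq2 z.
    by apply: is_derive_eq; rewrite /GRing.scale/=; ring.
  split.
  - apply: continuous_subspaceT => z; apply/differentiable_continuous/derivable1_diffP.
    by case: (dphi z).
  - by rewrite p1N p2N /wave !mul0r subrr.
  - by rewrite p1P p2P /wave !mul0r subrr.
  - exists (wave k%:~R (q1 (-1)) (q2 (-1)) x) => z; rewrite in_itv/= => /andP[z1 _].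
    rewrite -(@FTC_itvoo (fun y => wave k%:~R (o1 y) (o2 y) x)
      (fun y => wave k%:~R (q1 y) (q2 y) x))//.
    move=> y; apply: (@continuous_comp _ _ _ (fun y => (x, y)) (plane_wave k o1 o2));
      last exact: co.
    by apply: continuous_pair; [exact: cst_continuous|move=> ?; exact: cvg_id].
move=> psi tpsi; split; cbn [fst snd].
  rewrite (plane_wave_by_parts _ (smooth_continuous sr1) (smooth_continuous sr2) tpsi).
  apply: eq_Rintegral => p _; congr (_ * _); rewrite drho_s.
  have [E1 E2 _ _] := E p.2.
  transitivity (wave k%:~R (U_s p.2 * r1 p.2 + N p.2 * p1 p.2)
                           (U_s p.2 * r2 p.2 + N p.2 * p2 p.2) p.1).
    by rewrite -E1 -[_ + _ * p1 p.2]opprK -E2.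
  by rewrite /plane_wave /wave; ring.
rewrite (plane_wave_by_parts _ (smooth_continuous so1) (smooth_continuous so2) tpsi).
apply: eq_Rintegral => p _; congr (_ * _); rewrite ddU_s.
have [_ _ E3 E4] := E p.2.
transitivity (wave k%:~R (U_s p.2 * o1 p.2 - ddU p.2 * p1 p.2 - r1 p.2)
                         (U_s p.2 * o2 p.2 - ddU p.2 * p2 p.2 - r2 p.2) p.1).
  by rewrite -E3 -[_ - r1 p.2]opprK -E4.
by rewrite /plane_wave /wave; ring.
Qed.

End NormalModeGraph.

(** * Normal modes as eigenvectors, and the unstable spectrum *)

Section Spectrum.
Context {R : realType}.
Variables rho_s U_s N ddU : R -> R.
Hypothesis drho_s : forall z, rho_s^`()%classic z = - N z.
Hypothesis ddU_s : forall z, U_s^`(2)%classic z = ddU z.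

(** This is multiplication by [- i]. The real part of the rotated mode is the imaginary part of the
    original one, so the complex graph follows from two uses of the real one. *)
Lemma normal_mode_rot r1 r2 o1 o2 p1 p2 :
  normal_mode U_s N ddU r1 r2 o1 o2 p1 p2 ->
  normal_mode U_s N ddU r2 (fun z => - r1 z) o2 (fun z => - o1 z)
    p2 (fun z => - p1 z).
Proof.
move=> [[sr1 sr2 so1 so2] [sp1 sp2 [q1 dp1 dq1] D2] [p1N p1P p2N p2P] E]; split.
- by split => //; exact: smoothN.
- split => //; first exact: smoothN.
  exists (fun z => - q1 z) => z.
    by have d := dp1 z; exact: is_deriveN.
  by have d := dq1 z; exact: is_deriveN.
- by rewrite p1N p1P p2N p2P oppr0.
- move=> z; have [E1 E2 E3 E4] := E z.
  by split; [rewrite E2|rewrite [in LHS]E1|rewrite E4|rewrite [in LHS]E3]; ring.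
Qed.

Definition complex_profile (a b : R -> R) (z : R) : R[i] := (a z +i* b z)%C.

Lemma reS_fourier_mode k r1 r2 o1 o2 :
  reS (fourier_mode k (complex_profile r1 r2) (complex_profile o1 o2)) =
  (plane_wave k r1 r2, plane_wave k o1 o2).
Proof.
by congr pair; apply/funext => p; rewrite /plane_wave /wave /=; ring.
Qed.

Lemma imS_fourier_mode k r1 r2 o1 o2 :
  imS (fourier_mode k (complex_profile r1 r2) (complex_profile o1 o2)) =
  (plane_wave k r2 (fun z => - r1 z), plane_wave k o2 (fun z => - o1 z)).
Proof.
by congr pair; apply/funext => p; rewrite /plane_wave /wave /=; ring.
Qed.

Lemma reS_scale (c : R) v :
  reS (scaleS (c%:C)%C v) = (fun p => c * (reS v).1 p, fun p => c * (reS v).2 p).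
Proof.
by congr pair; apply/funext => p /=; [case: (v.1 p)|case: (v.2 p)] => a b /=; ring.
Qed.

Lemma imS_scale (c : R) v :
  imS (scaleS (c%:C)%C v) = (fun p => c * (imS v).1 p, fun p => c * (imS v).2 p).
Proof.
by congr pair; apply/funext => p /=; [case: (v.1 p)|case: (v.2 p)] => a b /=; ring.
Qed.

Lemma normal_mode_graph r1 r2 o1 o2 p1 p2 k :
  normal_mode U_s N ddU r1 r2 o1 o2 p1 p2 ->
  let v := fourier_mode k (complex_profile r1 r2) (complex_profile o1 o2) in
  hydro_graph rho_s U_s v (scaleS ((k%:~R : R)%:C)%C v).
Proof.
move=> mode v; split.
  by rewrite reS_scale reS_fourier_mode; exact: normal_mode_graphR mode.
rewrite imS_scale imS_fourier_mode.
exact: normal_mode_graphR (normal_mode_rot mode).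
Qed.

Lemma subS0 (v : @state R) : subS v (fun=> 0, fun=> 0) = v.
Proof. by case: v => v1 v2; congr pair; apply/funext => p /=; rewrite subr0. Qed.

Lemma expi_neq0 (y : R) : expi y != 0.
Proof.
apply/eqP => -[c0 s0]; have := cos2Dsin2 y.
by rewrite c0 s0 expr0n addr0 => /eqP; rewrite eq_sym oner_eq0.
Qed.

(* If lam were in the resolvent set, the zero solution of the homogeneous
   problem would be unique up to null sets. *)
Lemma normal_mode_spectrum r1 r2 o1 o2 p1 p2 k :
  normal_mode U_s N ddU r1 r2 o1 o2 p1 p2 ->
  (forall z : R, z \in `]-1, 1[ -> complex_profile r1 r2 z != 0) ->
  spectrum rho_s U_s ((k%:~R : R)%:C)%C.
Proof.
move=> mode r0 [M res].
have L20 : L2 (fun _ : R * R => 0 : R) by apply: continuous_L2; exact: cst_continuous.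
have [v [_ _ vuniq]] := res (fun=> 0, fun=> 0) (And4 L20 L20 L20 L20).
have uniq r1' r2' o1' o2' p1' p2' (m : normal_mode U_s N ddU r1' r2' o1' o2' p1' p2') :=
  vuniq (fourier_mode k (complex_profile r1' r2') (complex_profile o1' o2')).
have := uniq _ _ _ _ _ _ mode; rewrite subS0 => /(_ (normal_mode_graph k mode)) ae1.
have := uniq _ _ _ _ _ _ (normal_mode0 U_s N ddU).
rewrite subS0 => /(_ (normal_mode_graph k (normal_mode0 U_s N ddU))) ae0.
have : (@mu2 R).-negligible (@Omega R).
  (* Where both almost-everywhere identities hold, the mode and zero both equal [v], although the
     mode does not vanish inside the channel. Hence two null sets would cover [Omega], whose measure
     is [4 pi]. *)
  apply: negligibleS (negligibleU ae1 ae0) => p Op; apply: contrapT.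
  move/not_orP => -[/contrapT m1 /contrapT m0].
  have [+ _] := m1 Op; have [<- _] := m0 Op => /eqP.
  rewrite [X in _ == X](_ : _ = 0); last by rewrite /= mulr0.
  rewrite mulf_eq0 (negbTE (expi_neq0 _))/= (negbTE (r0 _ _))//; by case: Op.
move=> nO; have : @mu2 R (@Omega R) = 0.
  by apply/negligibleP; [exact: measurable_Omega|exact: nO].
by rewrite mu2_Omega => -[]; have := pi_gt0 R; lra.
Qed.

End Spectrum.

(** * The theorem *)

Section ProfileAnalytic.
Context {R : realType}.

Let horner_simpl := (@hornerD R, @hornerN R, @hornerZ R, @hornerXn R, @hornerX R, @hornerC R).

Lemma analytic_shear (z0 : R) : analytic_at shear z0.
Proof.
pose p : {poly R} := 'X * ((65%:P + 29 *: 'X + 308 *: 'X^2) \Po 'X^2).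
pose q : {poly R} := ((1%:P + 2 *: 'X) \Po 'X^2) ^+ 2.
have qE z : q.[z] = tfac (z ^+ 2) ^+ 2.
  by rewrite /q horner_exp horner_comp hornerXn /tfac !horner_simpl.
rewrite (_ : shear = fun z => p.[z] / q.[z]).
  apply/geometric_expansion_analytic/rational_geometric_expansion.
  by rewrite qE expf_neq0// gt_eqF// tfac_gt0// sqr_ge0.
apply/funext => z; rewrite qE /p hornerM horner_comp !hornerXn hornerX.
rewrite /shear /shear_num; set w := z ^+ 2.
by rewrite !horner_simpl; congr (_ / _); ring.
Qed.

(** An antiderivative of a rational function need not be rational, so the expansion of the integrand
    is integrated. *)
Lemma analytic_bvf_antiderivative (F : R -> R) (z0 : R) :
  (forall z : R, is_derive z 1 F (- bvf z)) -> analytic_at F z0.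
Proof.
pose p : {poly R} := - 8 *: ((101%:P - 2779 *: 'X + (1649 * 10) *: 'X^2
  + (135 * 1000 + 299) *: 'X^3 - (1004 * 1000 + 722) *: 'X^4
  + (2310 * 1000 + 776) *: 'X^5) \Po 'X^2).
pose q : {poly R} := ((1%:P + 2 *: 'X) ^+ 4 * (1%:P + 11 *: 'X) ^+ 2) \Po 'X^2.
have qE z : q.[z] = tfac (z ^+ 2) ^+ 4 * sfac (z ^+ 2) ^+ 2.
  by rewrite /q horner_comp hornerXn hornerM !horner_exp !horner_simpl.
move=> dF; apply: (geometric_expansion_antiderivative dF).
rewrite (_ : (fun z => - bvf z) = fun z => p.[z] / q.[z]).
  apply: rational_geometric_expansion; rewrite qE.
  by rewrite mulf_neq0// expf_neq0// gt_eqF// ?tfac_gt0 ?sfac_gt0// sqr_ge0.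
apply/funext => z; rewrite qE /p hornerZ horner_comp hornerXn /bvf /bvf_num.
by set w := z ^+ 2; rewrite !horner_simpl -mulNr; congr (_ / _); ring.
Qed.

End ProfileAnalytic.

(** * Smooth amplitude and phase in the lower half-plane *)

Section Polar.
Context {R : realType}.

Lemma cos_atan_gt0 (h : R) : 0 < cos (atan h).
Proof. by rewrite cos_gt0_pihalf// atan_gtNpi2 atan_ltpi2. Qed.

Lemma sin_atan (h : R) : sin (atan h) = h * cos (atan h).
Proof. by rewrite -{2}[h]atanK /tan divfK// gt_eqF// cos_atan_gt0. Qed.

(* a + i b = (- b / cos (atan h)) e^(i (atan h - pi / 2)) with h = - a / b. *)
Lemma polar_lower (a b c x : R) (h := - a / b) : b < 0 ->
  c * (- b / cos (atan h)) * cos (- (x + atan h - pi / 2)) =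
    c * (a * cos x - b * sin x) /\
  c * (- b / cos (atan h)) * sin (- (x + atan h - pi / 2)) =
    - (c * (a * sin x + b * cos x)).
Proof.
move=> b0; have h0 := cos_atan_gt0 h; have := sin_atan h.
rewrite cosN sinN cosBpihalf sinBpihalf cosD sinD => ->.
have -> : a = - h * b by rewrite /h; field; rewrite lt_eqF.
by split; field; rewrite gt_eqF.
Qed.

End Polar.

Theorem theorem2p1 (R : realType) :
  exists rho_s U_s : R -> R,
    analytic_on_I rho_s /\ analytic_on_I U_s /\
    (forall z : R, z \in `[-1, 1] ->
       [/\ rho_s^`()%classic z < 0, U_s^`()%classic z != 0,
           0 < - rho_s^`()%classic z / `|U_s^`()%classic z| ^+ 2 &
           - rho_s^`()%classic z / `|U_s^`()%classic z| ^+ 2 < 1 / 4]) /\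
    exists c : R[i],
      0 < complex.Im c /\
      (forall k : int, k != 0 ->
         exists r w theta1 theta2 : R -> R,
           (smooth_on_I r /\ nonzero_on_I r) /\
           (smooth_on_I w /\ nonzero_on_I w) /\
           (smooth_on_I theta1 /\ nonzero_on_I theta1) /\
           (smooth_on_I theta2 /\ nonzero_on_I theta2) /\
           classical_solution rho_s U_s
             (fun t x z => r z * expR (k%:~R * complex.Im c * t)
                * cos (k%:~R * (x - complex.Re c * t) - theta1 z))
             (fun t x z => w z * expR (k%:~R * complex.Im c * t)
                * cos (k%:~R * (x - complex.Re c * t) - theta2 z))) /\
      (forall M : R, exists lam : R[i],
         unstable_spectrum rho_s U_s lam /\ (M%:C)%C < `|lam|) /\
      (forall k : int,
         let lam : R[i] := - ('i)%C * k%:~R * c in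
         complex.Re lam = k%:~R * complex.Im c /\
         (0 < complex.Re lam ->
          unstable_spectrum rho_s U_s lam /\
          exists rhat what : R -> R[i],
            [/\ smoothC_on_I rhat, smoothC_on_I what,
                nonzero_on_I rhat, nonzero_on_I what &
                hydro_graph rho_s U_s (fourier_mode k rhat what)
                  (scaleS lam (fourier_mode k rhat what))])).
Proof.
have [lam1 lam10 dlam1] := exists_antiderivative 0 (smooth_continuous (@smooth_growth R)).
(* The value [pi] at 0 makes both phases nonzero functions: they equal [- pi] and [- pi / 2]
   there. *)
have [lam2 lam20 dlam2] := exists_antiderivative pi (smooth_continuous (@smooth_rotation R)).
have [rho_s _ drho_s] := exists_antiderivative 0
  (smooth_continuous (smoothN (@smooth_bvf R))).
have slam1 : smooth lam1 := smooth_antiderivative dlam1 (@smooth_growth R).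
have slam2 : smooth lam2 := smooth_antiderivative dlam2 (@smooth_rotation R).
have drhoE z : rho_s^`()%classic z = - bvf z by rewrite derive1E; case: (drho_s z).
have dUE : (@shear R)^`()%classic = dshear.
  by apply/funext => z; rewrite derive1E; case: (is_derive_shear z).
have ddUE z : (@shear R)^`(2)%classic z = ddshear z.
  by rewrite derive1nS derive1n1 dUE derive1E; case: (is_derive_dshear z).
have mode := explicit_normal_mode dlam1 dlam2; have := mode.
set r1 := fun z => - bvf z * _ * ecos _ _ z; set r2 := fun z => - bvf z * _ * esin _ _ z.
set o1 := fun z => _ * (_ - _ * esin _ _ z); set o2 := fun z => _ * (_ + _ * ecos _ _ z).
move: mode => _ mode.
have I0 : 0 \in `[-1, 1 : R] by rewrite in_itv/=; apply/andP; split; lra.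
have om0 z : om_im (z ^+ 2) < 0 :> R by rewrite om_im_lt0// sqr_ge0.
(* As [om_im] is negative, the factor [z om_re + i om_im] stays in the lower half-plane and
   [atan h - pi / 2] is a smooth argument of it, without branch jumps. *)
pose h z : R := - (z * om_re (z ^+ 2)) / om_im (z ^+ 2).
have h0 : h 0 = 0 by rewrite /h mul0r oppr0 mul0r.
have sh : smooth h.
  apply: smooth_quotient; last exact: smooth_om_im.
  - by move=> z; rewrite lt_eqF.
  - exact/smoothN/smooth_om_re.
have s1w : smooth (fun z : R => 1 - z ^+ 2).
  by apply: smoothB; [exact: smooth_cst|apply: smoothX; exact: smooth_id].
have r_neq0 (z : R) : z \in `]-1, 1[ -> complex_profile r1 r2 z != 0.
  rewrite in_itv/= => /andP[z1 z2]; apply/eqP => -[r10 r20].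
  have A0 : - bvf z * (1 - z ^+ 2) * expR (lam1 z) != 0.
    rewrite !mulf_neq0// ?oppr_eq0 gt_eqF ?bvf_gt0 ?expR_gt0//; nra.
  have c0 : cos (lam2 z) = 0.
    by apply: (mulfI A0); rewrite mulr0 -[RHS]r10 /r1 /ecos mulrA.
  have s0 : sin (lam2 z) = 0.
    by apply: (mulfI A0); rewrite mulr0 -[RHS]r20 /r2 /esin mulrA.
  have := cos2Dsin2 (lam2 z).
  by rewrite c0 s0 expr0n addr0 => /eqP; rewrite eq_sym oner_eq0.
have spec (k : int) : 0 < (k%:~R : R) ->
    unstable_spectrum rho_s shear ((k%:~R : R)%:C)%C.
  by move=> k0; split => //; exact: normal_mode_spectrum mode r_neq0.
exists rho_s, shear; split; [|split; [|split]].
- by move=> z _; exact: analytic_bvf_antiderivative.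
- by move=> z _; exact: analytic_shear.
- move=> z _; have U0 := dshear_gt0 z; have N0 := bvf_gt0 z.
  rewrite drhoE dUE opprK gtr0_norm//; split; last exact: richardson_lt.
  - by rewrite oppr_lt0.
  - by rewrite gt_eqF.
  - by rewrite divr_gt0// exprn_gt0.
exists 'i%C; split; [exact: ltr01|split; [|split]].
- move=> k _.
  (* The amplitudes are signed, so the factor [1 - z^2] enters without absolute value and they stay
     smooth through its zeros at the walls. *)
  exists (fun z => - bvf z * (1 - z ^+ 2) * expR (lam1 z)).
  exists (fun z => (1 - z ^+ 2) * expR (lam1 z) * (- om_im (z ^+ 2) / cos (atan (h z)))).
  exists (fun z => - lam2 z), (fun z => - (lam2 z + atan (h z) - pi / 2)).
  have pi0 := pi_gt0 R.
  split; [split|split; [split|split; [split|split; [split|]]]].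
  + apply: smooth_smooth_on_I; apply: smoothM; last exact: smooth_expR.
    by apply: smoothM => //; apply: smoothN; exact: smooth_bvf.
  + exists 0 => //; rewrite !mulf_neq0// ?oppr_eq0 gt_eqF ?bvf_gt0 ?expR_gt0//.
    by rewrite expr0n subr0.
  + apply: smooth_smooth_on_I; apply: smoothM.
      by apply: smoothM => //; exact: smooth_expR.
    apply: smooth_quotient.
    * by move=> z; rewrite gt_eqF// cos_atan_gt0.
    * by apply: smoothN; exact: smooth_om_im.
    * by apply: smooth_cos; exact: smooth_atan.
  + exists 0 => //; rewrite !mulf_neq0 ?invr_neq0 ?oppr_eq0//.
    * by rewrite expr0n subr0 oner_neq0.
    * by rewrite gt_eqF ?expR_gt0.
    * by rewrite lt_eqF.
    * by rewrite gt_eqF ?cos_atan_gt0.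
  + exact/smooth_smooth_on_I/smoothN.
  + by exists 0 => //; rewrite lam20 oppr_eq0 gt_eqF.
  + apply/smooth_smooth_on_I/smoothN/smoothB; last exact: smooth_cst.
    by apply: smoothD => //; exact: smooth_atan.
  + by exists 0 => //; rewrite lam20 h0 atan0 oppr_eq0 gt_eqF//; lra.
  + apply: (normal_mode_classical drhoE ddUE mode) => z.
    * by rewrite cosN /r1 /ecos; ring.
    * by rewrite sinN /r2 /esin; ring.
    * have [-> _] := polar_lower (z * om_re (z ^+ 2))
        ((1 - z ^+ 2) * expR (lam1 z)) (lam2 z) (om0 z).
      by rewrite /o1 /ecos /esin; ring.
    * have [_ ->] := polar_lower (z * om_re (z ^+ 2))
        ((1 - z ^+ 2) * expR (lam1 z)) (lam2 z) (om0 z).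
      by rewrite /o2 /ecos /esin; ring.
- move=> M; pose n := (Num.bound `|M|).+1.
  exists ((n%:~R : R)%:C)%C; split; first by apply: spec; rewrite ltr0n.
  rewrite ger0_norm ?lecR ?ler0n// ltcR (le_lt_trans (ler_norm M))//.
  by rewrite (lt_trans (archi_boundP (normr_ge0 M)))// ltr_nat.
- move=> k lam; have lamE : lam = ((k%:~R : R)%:C)%C.
    rewrite /lam mulrAC mulNr -expr2 sqr_i opprK mul1r.
    by rewrite -(rmorph_int (real_complex R)).
  rewrite lamE /=; split; first by rewrite mulr1.
  move=> k0; split; first exact: spec.
  have [[sr1 sr2 so1 so2] _ _ _] := mode.
  exists (complex_profile r1 r2), (complex_profile o1 o2); split.
  + by split; exact: smooth_smooth_on_I.
  + by split; exact: smooth_smooth_on_I.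
  + exists 0 => //; apply: r_neq0; rewrite in_itv/=; apply/andP; split; lra.
  + exists 0 => //; apply/eqP => -[_ o20].
    have : om_im (0 ^+ 2) * expR (lam1 0) = 0.
      transitivity (- o2 0); last by rewrite (_ : o2 0 = 0) ?oppr0.
      by rewrite /o2 /ecos lam20 cospi; ring.
    by move/eqP; rewrite mulf_eq0 (lt_eqF (om0 0)) gt_eqF ?expR_gt0.
  + exact: normal_mode_graph mode.
Qed.
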